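(* Let $0<d<n$ be integers. There exist $\varepsilon_0>0$ and $C\ge1$, depending only on $n$ and $d$, such that for $0<\varepsilon\le\varepsilon_0$ and every coherent collection of balls and planes (CCBP) $(\Sigma_0,\{B_{j,k}\},\{P_{j,k}\})$ with constant $\varepsilon$, there is a bijection $g:\mathbb{R}^n\to\mathbb{R}^n$ with the following properties: $$g(z)=z\ \text{ when }\mathrm{dist}(z,\Sigma_0)\ge2,$$ $$|g(z)-z|\le C\varepsilon\ \text{ for } z\in\mathbb{R}^n,$$ $$\tfrac14|z'-z|^{1+C\varepsilon}\le|g(z')-g(z)|\le3|z'-z|^{1-C\varepsilon}\ \text{ for } z,z'\in\mathbb{R}^n\text{ with }|z'-z|\le1,$$ and $\Sigma=g(\Sigma_0)$ is a $C\varepsilon$-Reifenberg-flat set that contains the accumulation set $E_\infty$.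
   Context: Notation: $r_k=10^{-k}$ for $k\in\mathbb{N}$. For sets $E,F$ that both meet $B(x,r)$, $d_{x,r}(E,F)=\frac1r\max\{\sup_{y\in E\cap B(x,r)}\mathrm{dist}(y,F),\ \sup_{y\in F\cap B(x,r)}\mathrm{dist}(y,E)\}$. A CCBP with constant $\varepsilon$ is a triple $(\Sigma_0,\{B_{j,k}\},\{P_{j,k}\})$ ($k\ge0$, $j\in J_k$) such that: (i) $\Sigma_0\subset\mathbb{R}^n$ is a smooth $d$-dimensional surface such that for each $x\in\Sigma_0$ there are an affine $d$-plane $P_x$ through $x$ and a $C^2$ function $F_x:P_x\to P_x^\perp$ ($P_x^\perp$ is the $(n-d)$-dimensional vector space orthogonal to $P_x$) with $|F_x(y)|+|DF_x(y)|+|D^2F_x(y)|\le\varepsilon$ for $y\in P_x$ and $\Sigma_0\cap B(x,200)=\Gamma_{F_x}\cap B(x,200)$, where $\Gamma_{F_x}=\{y+F_x(y):y\in P_x\}$. (ii) For each $k\ge0$, $\{x_{j,k}\}_{j\in J_k}$ is a collection of points of $\mathbb{R}^n$ with $|x_{i,k}-x_{j,k}|\ge r_k$ for $i\ne j$; $B_{j,k}=B(x_{j,k},r_k)$; with $V_k^\lambda=\bigcup_{j\in J_k}B(x_{j,k},\lambda r_k)$, one has $x_{j,k}\in V_{k-1}^2$ for $k\ge1$, $j\in J_k$; and $\mathrm{dist}(x_{j,0},\Sigma_0)\le\varepsilon$ for $j\in J_0$. (iii) For $k\ge0$ and $j\in J_k$, $P_{j,k}$ is an affine $d$-plane through $x_{j,k}$,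 and: $d_{x_{j,k},100r_k}(P_{i,k},P_{j,k})\le\varepsilon$ for $k\ge 0$ and $i,j\in J_k$ with $|x_{i,k}-x_{j,k}|\le100r_k$; $d_{x_{i,0},100}(P_{i,0},P_x)\le\varepsilon$ for $i\in J_0$ and $x\in\Sigma_0$ with $|x_{i,0}-x|\le2$; $d_{x_{i,k},20r_k}(P_{i,k},P_{j,k+1})\le\varepsilon$ for $k\ge 0$, $i\in J_k$ and $j\in J_{k+1}$ with $|x_{i,k}-x_{j,k+1}|\le2r_k$. $E_\infty$ is the set of $x\in\mathbb{R}^n$ that can be written $x=\lim_{m\to\infty}x_{j(m),k(m)}$ with $k(m)\in\mathbb{N}$, $j(m)\in J_{k(m)}$ and $\lim_{m\to\infty}k(m)=+\infty$. $\Sigma$ is $\delta$-Reifenberg-flat if for every $x\in\Sigma$ and $0<t\le1$ there is an affine $d$-plane $P(x,t)$ through $x$ with $d_{x,t}(\Sigma,P(x,t))\le\delta$. *)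

(* Defs.v *)
From HB Require Import structures.
From mathcomp Require Import all_boot all_order all_algebra.
From mathcomp Require Import all_classical all_reals all_analysis.
Import Order.TTheory GRing.Theory Num.Theory.
Import numFieldNormedType.Exports.

Set Implicit Arguments.
Unset Strict Implicit.
Unset Printing Implicit Defensive.

Local Open Scope classical_set_scope.
Local Open Scope ring_scope.

Section Euclidean.
Context {R : realType} {n : nat}.
Implicit Types (x y z u v : 'rV[R]_n) (E F P : set 'rV[R]_n).

Definition dotp u v : R := \sum_(i < n) u 0 i * v 0 i.

(* The library norm on ['rV_n] is the sup norm; all distances below are
   Euclidean.  Topological notions (limits, continuity, derivatives) are the
   library ones, since the two norms induce the same topology. *)
Definition enorm u : R := Num.sqrt (dotp u u).

Definition eball x (r : R) : set 'rV[R]_n := [set y | enorm (y - x) < r].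

(* Extended-real valued, so that the distance to the empty set is [+oo]. *)
Definition set_dist y F : \bar R := ereal_inf [set (enorm (y - z))%:E | z in F].

Definition local_dist x (r : R) E F : \bar R :=
  ((r^-1)%:E * maxe (ereal_sup [set set_dist y F | y in E `&` eball x r])
                    (ereal_sup [set set_dist y E | y in F `&` eball x r]))%E.

Definition affine_plane (d : nat) P : Prop :=
  exists (p : 'rV[R]_n) (V : {vspace 'rV[R]_n}),
    \dim V = d /\ P = [set y | y - p \in V].

Definition direction P : set 'rV[R]_n := [set y - z | y in P & z in P].

Definition orthogonal_to P v : Prop := forall u, direction P u -> dotp u v = 0.

(* For an affine plane [P], only the values of [f] on [P] matter: derivatives
   are taken at points of [P], in directions parallel to [P]. *)
Definition C2_on P (f : 'rV[R]_n -> 'rV[R]_n) : Prop :=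
  {within P, continuous f} /\
  forall u v, direction P u -> direction P v ->
    [/\ forall y, P y -> derivable f y u,
        {within P, continuous ('D_u f)},
        forall y, P y -> derivable ('D_u f) y v &
        {within P, continuous ('D_v ('D_u f))}].

Definition unit_direction P : set 'rV[R]_n :=
  [set u | direction P u /\ enorm u <= 1].

(* Operator norms of the first and second derivatives of [f] along [P]. *)
Definition D1_norm P (f : 'rV[R]_n -> 'rV[R]_n) y : \bar R :=
  ereal_sup [set (enorm ('D_u f y))%:E | u in unit_direction P].

Definition D2_norm P (f : 'rV[R]_n -> 'rV[R]_n) y : \bar R :=
  ereal_sup [set (enorm ('D_v ('D_u f) y))%:E |
              u in unit_direction P & v in unit_direction P].

Definition graph_over P (f : 'rV[R]_n -> 'rV[R]_n) : set 'rV[R]_n :=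
  [set y + f y | y in P].

Definition reifenberg_flat (d : nat) (delta : R) E : Prop :=
  forall x (t : R), E x -> 0 < t <= 1 ->
    exists P, [/\ affine_plane d P, P x & (local_dist x t E P <= delta%:E)%E].

End Euclidean.

Section CCBP.
Context {R : realType} {n : nat}.

Definition radius (k : nat) : R := 10 ^- k.

(* The balls [B_{j,k}] are determined by their centers: see [ccbp_ball]. *)
Record ccbp_data := CcbpData {
  surface : set 'rV[R]_n;
  index : nat -> Type;
  center : forall k, index k -> 'rV[R]_n;
  plane : forall k, index k -> set 'rV[R]_n
}.

Definition ccbp_ball (X : ccbp_data) (lambda : R) k (j : index X k) :
    set 'rV[R]_n :=
  eball (center j) (lambda * radius k).

Definition ccbp_nbhd (X : ccbp_data) (lambda : R) k : set 'rV[R]_n :=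
  \bigcup_(j in [set: index X k]) ccbp_ball lambda j.

(* [Px x] and [Fx x] are the plane and the function given at [x]; they are
   irrelevant when [x] is not on the surface.  Smoothness of the surface is
   this local C^2 graph condition. *)
Definition smooth_surface (d : nat) (eps : R) (S : set 'rV[R]_n)
    (Px : 'rV[R]_n -> set 'rV[R]_n)
    (Fx : 'rV[R]_n -> 'rV[R]_n -> 'rV[R]_n) : Prop :=
  forall x, S x ->
    [/\ affine_plane d (Px x) /\ Px x x,
        forall y, Px x y -> orthogonal_to (Px x) (Fx x y),
        C2_on (Px x) (Fx x),
        forall y, Px x y ->
          ((enorm (Fx x y))%:E + D1_norm (Px x) (Fx x) y
             + D2_norm (Px x) (Fx x) y <= eps%:E)%E &
        S `&` eball x 200 = graph_over (Px x) (Fx x) `&` eball x 200].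

Definition coherent_balls (eps : R) (X : ccbp_data) : Prop :=
  [/\ forall k (i j : index X k), i <> j ->
        radius k <= enorm (center i - center j),
      forall k (j : index X k.+1), ccbp_nbhd X 2 k (center j) &
      forall j : index X 0, (set_dist (center j) (surface X) <= eps%:E)%E].

Definition coherent_planes (d : nat) (eps : R) (X : ccbp_data)
    (Px : 'rV[R]_n -> set 'rV[R]_n) : Prop :=
  [/\ forall k (j : index X k),
        affine_plane d (plane j) /\ plane j (center j),
      forall k (i j : index X k),
        enorm (center i - center j) <= 100 * radius k ->
        (local_dist (center j) (100 * radius k) (plane i) (plane j)
           <= eps%:E)%E,
      forall (i : index X 0) x, surface X x -> enorm (center i - x) <= 2 ->
        (local_dist (center i) 100 (plane i) (Px x) <= eps%:E)%E &
      forall k (i : index X k) (j : index X k.+1),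
        enorm (center i - center j) <= 2 * radius k ->
        (local_dist (center i) (20 * radius k) (plane i) (plane j)
           <= eps%:E)%E].

Definition is_CCBP (d : nat) (eps : R) (X : ccbp_data) : Prop :=
  exists Px Fx,
    [/\ smooth_surface d eps (surface X) Px Fx,
        coherent_balls eps X &
        coherent_planes d eps X Px].

Definition accumulation_set (X : ccbp_data) : set 'rV[R]_n :=
  [set x | exists (k : nat -> nat) (j : forall m, index X (k m)),
     k m @[m --> \oo] --> \oo /\ center (j m) @[m --> \oo] --> x].

End CCBP.

Arguments ccbp_data R n : clear implicits.

(* Main.v *)
(** The surface [S_k] of generation [k] is moved by averaging, with a Lipschitz
    partition of unity, its projections on the planes of generation [k].  Since
    [S_k] is near these planes a graph of slope O(eps), this displacement is, on
    [S_k], O(eps)-Lipschitz and of size O(eps 10^-k).  Its McShane extension makes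
    it a perturbation of the identity of the whole space, hence a bijection which
    is bi-Lipschitz with constants 1 +- O(eps).  The slope of [S_{k+1}] at the next
    scale is again O(eps), with a constant that depends only on the mutual position
    of the planes, because projecting cancels the normal component of [S_k].

    The composition of these maps converges to [g].  Its Hoelder exponents come from
    using the bi-Lipschitz bounds until the images of two points are at distance
    10^-k, after which they move little compared with this distance.  At a point of
    the limit and a scale about 10^-k, either the point is near a center of
    generation [k], and flatness is that of [S_k], or the surface has stopped moving
    there at an earlier generation, when it was a graph of slope O(eps). *)
Require Import Defs.
From HB Require Import structures.
From mathcomp Require Import all_boot all_order all_algebra.
From mathcomp Require Import all_classical all_reals all_analysis.
From mathcomp Require Import ring lra.
Import Order.TTheory GRing.Theory Num.Theory.
Import numFieldNormedType.Exports.

Set Implicit Arguments.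
Unset Strict Implicit.
Unset Printing Implicit Defensive.

Local Open Scope classical_set_scope.
Local Open Scope ring_scope.

(* These names are also those of notions of the libraries loaded above. *)
Local Notation radius := Defs.radius.
Local Notation index := Defs.index.
Local Notation center := Defs.center.

(** The displacement is controlled only on the current surface, whose regularity after one step is
    merely Lipschitz. Flatness is therefore carried by inequalities on a set, without charts, and
    the induction must also carry the surjectivity of the projections on the planes, without which
    holes could open. This clause is restored at each step by a fixed point argument,
    [projection_lift]; it gives the second half of Reifenberg flatness and the points of the surface
    near each center.

    Four small numbers occur, all fixed multiples of [eps]: [delta] for the coherence of the planes,
    [a] for the flatness of the surfaces, [eta = n * Q * a] for the displacements and
    [theta = 2 * n * eta] for the distance to the limit. There is no circularity: the new flatness
    is bounded by a multiple of [delta] alone, so [a] is taken as a large multiple of [delta], and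
    afterwards only [eta] has to be small. The factors [n] come from arguing coordinate by
    coordinate or from comparing the Euclidean and sup norms. *)

Section EuclideanNorm.
Context {R : realType} {n : nat}.
Implicit Types (u v w x y z : 'rV[R]_n).

Lemma dotpC u v : dotp u v = dotp v u.
Proof. by apply: eq_bigr => i _; rewrite mulrC. Qed.

Lemma dotpDl u v w : dotp (u + v) w = dotp u w + dotp v w.
Proof.
by rewrite /dotp -big_split; apply: eq_bigr => i _; rewrite !mxE mulrDl.
Qed.

Lemma dotpZl (c : R) u v : dotp (c *: u) v = c * dotp u v.
Proof.
by rewrite /dotp mulr_sumr; apply: eq_bigr => i _; rewrite !mxE mulrA.
Qed.

Lemma dotpNl u v : dotp (- u) v = - dotp u v.
Proof. by rewrite -scaleN1r dotpZl mulN1r. Qed.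

Lemma dotpDr u v w : dotp u (v + w) = dotp u v + dotp u w.
Proof. by rewrite dotpC dotpDl !(dotpC u). Qed.

Lemma dotpZr (c : R) u v : dotp u (c *: v) = c * dotp u v.
Proof. by rewrite dotpC dotpZl (dotpC u). Qed.

Lemma dotpNr u v : dotp u (- v) = - dotp u v.
Proof. by rewrite dotpC dotpNl (dotpC u). Qed.

Lemma dotp_ge0 u : 0 <= dotp u u.
Proof. by apply: sumr_ge0 => i _; rewrite -expr2 sqr_ge0. Qed.

Lemma enorm_ge0 u : 0 <= enorm u.
Proof. exact: sqrtr_ge0. Qed.

Lemma sqr_enorm u : enorm u ^+ 2 = dotp u u.
Proof. by rewrite sqr_sqrtr ?dotp_ge0. Qed.

Lemma enorm_le_sqr u (c : R) : 0 <= c -> dotp u u <= c ^+ 2 -> enorm u <= c.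
Proof.
move=> c0 h; rewrite -(ler_pXn2r (_ : 0 < 2)%N) ?nnegrE ?enorm_ge0//.
by rewrite sqr_enorm.
Qed.

Lemma enorm0 : enorm (0 : 'rV[R]_n) = 0.
Proof.
rewrite /enorm (_ : dotp _ _ = 0) ?sqrtr0//.
by rewrite /dotp big1// => i _; rewrite mxE mul0r.
Qed.

Lemma enormN u : enorm (- u) = enorm u.
Proof. by rewrite /enorm dotpNl dotpNr opprK. Qed.

Lemma enormB u v : enorm (u - v) = enorm (v - u).
Proof. by rewrite -enormN opprB. Qed.

Lemma enormZ (c : R) u : enorm (c *: u) = `|c| * enorm u.
Proof.
by rewrite /enorm dotpZl dotpZr mulrA -expr2 sqrtrM ?sqr_ge0// sqrtr_sqr.
Qed.

Lemma ler_coord_enorm u i : `|u 0 i| <= enorm u.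
Proof.
rewrite -sqrtr_sqr ler_wsqrtr// /dotp (bigD1 i)//= expr2 lerDl.
by apply: sumr_ge0 => j _; rewrite -expr2 sqr_ge0.
Qed.

Lemma enorm_eq0 u : enorm u = 0 -> u = 0.
Proof.
move=> h; apply/rowP => i; rewrite mxE; apply/eqP; rewrite -normr_le0 -h.
exact: ler_coord_enorm.
Qed.

Lemma cauchy_schwarz u v : dotp u v <= enorm u * enorm v.
Proof.
have [/eqP|u0] := boolP (enorm u == 0).
  by move/enorm_eq0 => ->; rewrite enorm0 mul0r -(scale0r 0) dotpZl mul0r.
have [/eqP|v0] := boolP (enorm v == 0).
  by move/enorm_eq0 => ->; rewrite enorm0 mulr0 -(scale0r 0) dotpZr mul0r.
have up : 0 < enorm u by rewrite lt_neqAle eq_sym u0 enorm_ge0.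
have vp : 0 < enorm v by rewrite lt_neqAle eq_sym v0 enorm_ge0.
have := dotp_ge0 (enorm v *: u - enorm u *: v).
rewrite dotpDl !dotpDr !dotpNl !dotpNr !dotpZl !dotpZr (dotpC v u).
rewrite -!sqr_enorm.
set a := enorm u; set b := enorm v; set c := dotp u v => h.
have {}h : 0 <= 2 * (a * b) * (a * b - c) by nra.
by rewrite -subr_ge0 -(pmulr_rge0 _ (_ : 0 < 2 * (a * b)))// !mulr_gt0.
Qed.

Lemma ler_enormD u v : enorm (u + v) <= enorm u + enorm v.
Proof.
apply: enorm_le_sqr; first by rewrite addr_ge0 ?enorm_ge0.
rewrite dotpDl !dotpDr (dotpC v u) -!sqr_enorm.
have := cauchy_schwarz u v; nra.
Qed.

Lemma ler_enormB u v : enorm (u - v) <= enorm u + enorm v.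
Proof. by rewrite (le_trans (ler_enormD _ _))// enormN. Qed.

Lemma enorm_triangle z x y : enorm (x - y) <= enorm (x - z) + enorm (z - y).
Proof. by rewrite -{1}(subrK z x) -addrA ler_enormD. Qed.

Lemma enorm_sum (I : Type) (s : seq I) (P : pred I) (F : I -> 'rV[R]_n) :
  enorm (\sum_(i <- s | P i) F i) <= \sum_(i <- s | P i) enorm (F i).
Proof.
elim/big_ind2: _ => [|u a v b ha hb|//]; first by rewrite enorm0.
by rewrite (le_trans (ler_enormD _ _))// lerD.
Qed.

Lemma enorm_le_coord u (c : R) :
  (forall i, `|u 0 i| <= c) -> enorm u <= n%:R * c.
Proof.
move=> h; rewrite (row_sum_delta u) (le_trans (enorm_sum _ _ _))//.
have -> : n%:R * c = \sum_(i < n) c by rewrite sumr_const card_ord mulr_natl.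
apply: ler_sum => i _; rewrite enormZ.
suff -> : enorm (delta_mx 0 i : 'rV[R]_n) = 1 by rewrite mulr1.
rewrite /enorm /dotp (bigD1 i)//= big1 ?addr0 ?mxE ?eqxx ?mulr1 ?sqrtr1//.
by move=> j ji; rewrite mxE eqxx (negbTE ji) mulr0.
Qed.

Lemma ler_norm_enorm u : `|u| <= enorm u.
Proof.
rewrite [leLHS]/Num.Def.normr/= mx_normrE; apply: bigmax_le.
  exact: enorm_ge0.
by move=> -[i j] _; rewrite ord1 ler_coord_enorm.
Qed.

Lemma ler_enorm_norm u : enorm u <= n%:R * `|u|.
Proof.
apply: enorm_le_coord => i.
rewrite [leRHS]/Num.Def.normr/= mx_normrE.
exact: (le_bigmax _ (fun ij : 'I_1 * 'I_n => `|u ij.1 ij.2|) (0, i)).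
Qed.

End EuclideanNorm.

(** * Orthogonal projections and tilt between subspaces *)

Definition orthoproj {R : realType} {n : nat} (p : 'M[R]_n) : Prop :=
  p^T = p /\ p *m p = p.

(** Vectors are rows and stand on the left of matrices: this is the component of [u] normal to the
    range of an orthogonal projection. Distances to planes and slopes over planes are measured by
    its norm. *)
Definition perp {R : realType} {n : nat} (p : 'M[R]_n) (u : 'rV[R]_n) :=
  u - u *m p.

Section Projections.
Context {R : realType} {n : nat}.
Implicit Types (u v w : 'rV[R]_n) (p q : 'M[R]_n).

Lemma dotpE u v : dotp u v = (u *m v^T) 0 0.
Proof. by rewrite mxE; apply: eq_bigr => i _; rewrite mxE. Qed.

Lemma dotp_mulmx u v p : dotp (u *m p) v = dotp u (v *m p^T).
Proof. by rewrite !dotpE trmx_mul trmxK mulmxA. Qed.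

Lemma perpD p u v : perp p (u + v) = perp p u + perp p v.
Proof. by rewrite /perp mulmxDl opprD addrACA. Qed.

Lemma perpN p u : perp p (- u) = - perp p u.
Proof. by rewrite /perp mulNmx opprD. Qed.

Lemma perpB p u v : perp p (u - v) = perp p u - perp p v.
Proof. by rewrite perpD perpN. Qed.

Lemma perpZ p (c : R) u : perp p (c *: u) = c *: perp p u.
Proof. by rewrite /perp -scalemxAl scalerBr. Qed.

Lemma perp_sum p (I : Type) (s : seq I) (F : I -> 'rV[R]_n) :
  perp p (\sum_(i <- s) F i) = \sum_(i <- s) perp p (F i).
Proof.
elim: s => [|i s ih]; last by rewrite !big_cons perpD ih.
by rewrite !big_nil /perp mul0mx subr0.
Qed.

Lemma perp_id u p : u = u *m p + perp p u.
Proof. by rewrite /perp addrC subrK. Qed.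

Lemma perp_mul p u : orthoproj p -> perp p (u *m p) = 0.
Proof. by case=> _ pp; rewrite /perp -mulmxA pp subrr. Qed.

Lemma mul_perp p u : orthoproj p -> perp p u *m p = 0.
Proof. by case=> _ pp; rewrite /perp mulmxBl -mulmxA pp subrr. Qed.

Lemma pythagoras p u : orthoproj p ->
  enorm u ^+ 2 = enorm (u *m p) ^+ 2 + enorm (perp p u) ^+ 2.
Proof.
move=> hp; have : dotp (u *m p) (perp p u) = 0.
  by rewrite dotp_mulmx hp.1 mul_perp// -(scale0r 0) dotpZr mul0r.
rewrite !sqr_enorm => ab0; have -> : dotp u u = dotp (u *m p + perp p u) (u *m p + perp p u).
  by rewrite -perp_id.
move: (u *m p) (perp p u) ab0 => a b ab0.
by rewrite dotpDl !dotpDr (dotpC b a) ab0; lra.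
Qed.

Lemma enorm_proj p u : orthoproj p -> enorm (u *m p) <= enorm u.
Proof.
move=> hp; apply: enorm_le_sqr; first exact: enorm_ge0.
by rewrite (pythagoras u hp) -sqr_enorm lerDl sqr_ge0.
Qed.

Lemma enorm_perp p u : orthoproj p -> enorm (perp p u) <= enorm u.
Proof.
move=> hp; apply: enorm_le_sqr; first exact: enorm_ge0.
by rewrite (pythagoras u hp) -sqr_enorm lerDr sqr_ge0.
Qed.

Lemma enorm_proj_perp p u : enorm u <= enorm (u *m p) + enorm (perp p u).
Proof. by rewrite {1}(perp_id u p) ler_enormD. Qed.

(** With the rows of [A] a basis of [V], the projection is [A^T (A A^T)^-1 A]. The Gram matrix is
    invertible because [u A A^T = 0] forces [u A] to have norm 0, and a basis is free. *)
Lemma exists_orthoproj (V : {vspace 'rV[R]_n}) :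
  exists p, orthoproj p /\ forall v, (v \in V) = (v *m p == v).
Proof.
pose d := \dim V.
pose A := \matrix_(i < d) (vbasis V)`_i.
have mulA (c : 'rV_d) : c *m A = \sum_(i < d) c 0 i *: (vbasis V)`_i.
  by rewrite mulmx_sum_row; apply: eq_bigr => i _; rewrite rowK.
pose G := A *m A^T.
have Gunit : G \in unitmx.
  rewrite -row_free_unit; apply: inj_row_free => u uG0.
  have /enorm_eq0 : enorm (u *m A) = 0.
    apply/eqP; rewrite -sqrf_eq0 sqr_enorm dotpE trmx_mul mulmxA -(mulmxA u).
    by rewrite uG0 mul0mx mxE.
  rewrite mulA => uA0.
  have /freeP/(_ _ uA0) u0 := basis_free (vbasisP V).
  by apply/rowP => i; rewrite mxE u0.
have GT : G^T = G by rewrite /G trmx_mul trmxK.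
exists (A^T *m invmx G *m A); split; first split.
- by rewrite !trmx_mul trmxK trmx_inv GT mulmxA.
- by rewrite !mulmxA -(mulmxA _ A) -/G -(mulmxA _ (invmx G) G) mulVmx// mulmx1.
- move=> v; apply/idP/eqP => [vV|<-].
    have -> : v = (\row_i coord (vbasis V) i v) *m A.
      by rewrite mulA {1}(coord_vbasis vV); apply: eq_bigr => i _; rewrite mxE.
    by rewrite !mulmxA -(mulmxA _ A) -/G -(mulmxA _ G) mulmxV// mulmx1.
  rewrite mulmxA mulA; apply: memv_suml => i _.
  by rewrite memvZ// vbasis_mem// mem_nth// size_tuple.
Qed.

(* By self-adjointness, [q *m perp p] and [perp p *m q] have the same norm. *)
Lemma orthoproj_close p q (c : R) : orthoproj p -> orthoproj q -> 0 <= c ->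
  (forall u, enorm (perp p (u *m q)) <= c * enorm (u *m q)) ->
  (forall u, enorm (perp q (u *m p)) <= c * enorm (u *m p)) ->
  forall u, enorm (u *m p - u *m q) <= 2 * c * enorm u.
Proof.
move=> hp hq c0 hpq hqp u.
have -> : u *m p - u *m q = perp q u *m p - perp p (u *m q).
  by rewrite /perp mulmxBl; apply/rowP => i; rewrite !mxE; lra.
apply: le_trans (ler_enormB _ _) _.
have h1 : enorm (perp p (u *m q)) <= c * enorm u.
  exact: le_trans (hpq u) (ler_wpM2l c0 (enorm_proj _ hq)).
suff h2 : enorm (perp q u *m p) <= c * enorm u by lra.
set w := perp q u *m p.
have : enorm w ^+ 2 <= c * enorm w * enorm u.
  have -> : enorm w ^+ 2 = dotp (perp q w) (perp q u).
    have wE : dotp w w = dotp w (perp q u).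
      by rewrite /w dotp_mulmx hp.1 -mulmxA hp.2 dotpC.
    rewrite sqr_enorm wE {1}/perp dotpDl dotpNl dotp_mulmx hq.1.
    by rewrite mul_perp// -(scale0r 0) dotpZr mul0r subr0.
  apply: le_trans (cauchy_schwarz _ _) _.
  apply: ler_pM; rewrite ?enorm_ge0 ?enorm_perp//.
  exact: hqp.
have := enorm_ge0 w; rewrite le_eqVlt => /orP[/eqP <- _|w0 h].
  by rewrite mulr_ge0 ?enorm_ge0.
by rewrite -(ler_pM2l w0); lra.
Qed.

End Projections.

(* The library declares both structures on matrices, but not their join. *)
HB.instance Definition _ (R : realType) (m n : nat) := Complete.on 'M[R]_(m, n).

(** * Lipschitz extension and perturbations of the identity *)

Section LipschitzMaps.
Context {R : realType} {n : nat}.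
Implicit Types (u v w x y z : 'rV[R]_n) (S : set 'rV[R]_n).

Lemma norm_clampB (a b c : R) :
  `|Num.max (- c) (Num.min a c) - Num.max (- c) (Num.min b c)| <= `|a - b|.
Proof.
wlog ab : a b / a <= b => [hw|].
  by case: (leP a b) => [/hw//|/ltW/hw]; rewrite distrC (distrC b).
rewrite (ler0_norm (_ : a - b <= 0)) ?subr_le0// ler_norml; apply/andP.
by case: (leP a c) => ?; case: (leP b c) => ?; case: (leP (- c) a) => ?;
  case: (leP (- c) b) => ?; case: (leP (- c) c) => ?; split; lra.
Qed.

Lemma norm_clamp (a c : R) : 0 <= c -> `|Num.max (- c) (Num.min a c)| <= c.
Proof.
move=> c0; rewrite ler_norml le_max lexx/= ge_max ge_min lexx orbT andbT.
lra.
Qed.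

Lemma clamp_id (a c : R) : `|a| <= c -> Num.max (- c) (Num.min a c) = a.
Proof. by rewrite ler_norml => /andP[ca ac]; rewrite min_l// max_r. Qed.

(** The extension is the infimum over [S] of the cones [f s + L |z - s|]. For an empty [S] this
    infimum has no meaning, and a constant serves. *)
Lemma mcshane S (f : 'rV[R]_n -> R) (L : R) : 0 <= L ->
  (forall x y, S x -> S y -> `|f x - f y| <= L * enorm (x - y)) ->
  exists F : 'rV[R]_n -> R, (forall x, S x -> F x = f x) /\
    forall x y, `|F x - F y| <= L * enorm (x - y).
Proof.
move=> L0 lipf; have [[s0 Ss0]|S0] := pselect (S !=set0); last first.
  exists (fun=> 0); split=> [x Sx|x y]; first by case: S0; exists x.
  by rewrite subrr normr0 mulr_ge0 ?enorm_ge0.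
pose A z := [set f s + L * enorm (z - s) | s in S].
have A0 z : A z !=set0 by exists (f s0 + L * enorm (z - s0)), s0.
have lbA z : has_lbound (A z).
  exists (f s0 - L * enorm (z - s0)) => _ [s Ss <-].
  have := lipf s s0 Ss Ss0; rewrite ler_norml => /andP[h _].
  have := ler_wpM2l L0 (enorm_triangle z s s0).
  by rewrite (enormB s z) mulrDr; lra.
have le_inf z s : S s -> inf (A z) <= f s + L * enorm (z - s).
  by move=> Ss; apply: ge_inf => //; exists s.
have lipF x y : inf (A x) <= inf (A y) + L * enorm (x - y).
  rewrite -lerBlDr; apply: lb_le_inf => // _ [s Ss <-].
  have := le_inf x s Ss; have := ler_wpM2l L0 (enorm_triangle y x s).
  by rewrite mulrDr; lra.
exists (fun z => inf (A z)); split=> [x Sx|x y].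
  apply/eqP; rewrite eq_le; apply/andP; split.
    by have := le_inf x x Sx; rewrite subrr enorm0 mulr0 addr0.
  apply: lb_le_inf => // _ [s Ss <-].
  have := lipf s x Ss Sx; rewrite ler_norml => /andP[h _].
  by move: h; rewrite (enormB s x); lra.
rewrite ler_norml; apply/andP; split.
  by have := lipF y x; rewrite (enormB y x); lra.
by have := lipF x y; lra.
Qed.

(** Each coordinate is extended by [mcshane], then truncated to the interval from [- c] to [c]:
    truncation is 1-Lipschitz and fixes the values taken on [S]. Returning from coordinates to the
    Euclidean norm costs the factor [n]. *)
Lemma lipschitz_extension S (f : 'rV[R]_n -> 'rV[R]_n) (L c : R) :
  0 <= L -> 0 <= c ->
  (forall x y, S x -> S y -> enorm (f x - f y) <= L * enorm (x - y)) ->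
  (forall x, S x -> enorm (f x) <= c) ->
  exists F : 'rV[R]_n -> 'rV[R]_n,
    [/\ forall x, S x -> F x = f x,
        forall x y, enorm (F x - F y) <= n%:R * L * enorm (x - y) &
        forall x, enorm (F x) <= n%:R * c].
Proof.
move=> L0 c0 lipf bf.
have /choice[G hG] : forall i : 'I_n, exists G : 'rV[R]_n -> R,
    (forall x, S x -> G x = f x 0 i) /\
    forall x y, `|G x - G y| <= L * enorm (x - y).
  move=> i; apply: mcshane => // x y Sx Sy.
  rewrite (le_trans _ (lipf x y Sx Sy))//.
  by have := ler_coord_enorm (f x - f y) i; rewrite !mxE.
exists (fun x => \row_i Num.max (- c) (Num.min (G i x) c)); split.
- move=> x Sx; apply/rowP => i; rewrite mxE (hG i).1// clamp_id//.
  exact: le_trans (ler_coord_enorm _ _) (bf x Sx).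
- move=> x y; rewrite -mulrA; apply: enorm_le_coord => i; rewrite !mxE.
  exact: le_trans (norm_clampB _ _ _) ((hG i).2 x y).
- by move=> x; apply: enorm_le_coord => i; rewrite mxE norm_clamp.
Qed.

(** A solution is a fixed point of the map sending [z] to [w - h z]. The contraction theorem is
    applied for the sup norm, and the comparison of the two norms turns the constant [k] into
    [n * k]. *)
Lemma perturb_id_surj (h : 'rV[R]_n -> 'rV[R]_n) (k : R) :
  0 <= k -> n%:R * k < 1 ->
  (forall x y, enorm (h x - h y) <= k * enorm (x - y)) ->
  forall w, exists z, z + h z = w.
Proof.
move=> k0 k1 liph w.
pose f := [fun of totalfun (fun z : 'rV[R]_n => (w - h z : 'rV[R]_n))].
have ctr : is_contraction f.
  have nk0 : 0 <= n%:R * k by rewrite mulr_ge0.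
  exists (NngNum nk0); split => //= -[x y] _ /=.
  have -> : w - h x - (w - h y) = h y - h x by rewrite opprB addrC subrKA.
  apply: le_trans (ler_norm_enorm _) _; apply: le_trans (liph _ _) _.
  rewrite -normrN opprB mulrC [leRHS]mulrAC.
  by rewrite ler_wpM2r ?ler_enorm_norm.
have [||z _ zE] := @banach_fixed_point R 'rV[R]_n _ _ ctr.
- exact: closedT.
- by exists 0.
- by exists z; rewrite {1}zE /= /totalfun_ subrK.
Qed.

Lemma perturb_id_le (h : 'rV[R]_n -> 'rV[R]_n) (k : R) x y :
  enorm (h x - h y) <= k * enorm (x - y) ->
  enorm (x + h x - (y + h y)) <= (1 + k) * enorm (x - y).
Proof.
move=> hh; rewrite opprD addrACA (le_trans (ler_enormD _ _))// mulrDl mul1r.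
by rewrite lerD2l.
Qed.

Lemma perturb_id_ge (h : 'rV[R]_n -> 'rV[R]_n) (k : R) x y :
  enorm (h x - h y) <= k * enorm (x - y) ->
  (1 - k) * enorm (x - y) <= enorm (x + h x - (y + h y)).
Proof.
move=> hh; rewrite opprD addrACA mulrBl mul1r.
have := ler_enormB (x - y + (h x - h y)) (h x - h y); rewrite addrK; lra.
Qed.

End LipschitzMaps.

(** * Lifting points of a plane to a nearly flat set *)

Section ProjectionLift.
Context {R : realType} {n : nat}.
Implicit Types (u v w x y z : 'rV[R]_n) (A : set 'rV[R]_n) (p q : 'M[R]_n).

Lemma le_double_perp p (k : R) y : k <= 2^-1 -> enorm (perp p y) <= k * enorm y ->
  enorm y <= 2 * enorm (y *m p).
Proof. by move=> k1 h; have := enorm_proj_perp p y; have := enorm_ge0 y; nra. Qed.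

(* With [Y u] a lift of [u] to [A] along [p] and [psi] a Lipschitz extension of
   [tau (Y u) - u p], the lift of [v] is [Y z], where [z] solves
   [z + (z p - z + psi z) q = v], a small perturbation of [z = v]. *)
Lemma projection_lift A p q (tau : 'rV[R]_n -> 'rV[R]_n) x (k rho rad : R) :
  orthoproj p -> orthoproj q -> 0 <= k -> 0 < rho ->
  6 * (n%:R + 1) * (4 * n%:R + 1) * k <= 1 ->
  (forall u, enorm (u *m p - u *m q) <= k * enorm u) ->
  (forall y y', A y -> A y' -> enorm (perp p (y - y')) <= k * enorm (y - y')) ->
  (forall y y', A y -> A y' ->
     enorm (tau y - tau y' - (y - y')) <= k * enorm (y - y')) ->
  (forall y, A y -> enorm (tau y - y) <= k * rho) ->
  (forall y, A y -> enorm (perp p (y - x)) <= k * rho) ->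
  (forall u, enorm (u - x) < rad -> exists y, A y /\ (y - u) *m p = 0) ->
  forall v, enorm (v - x) + rho <= rad -> enorm (perp p (v - x)) <= k * rho ->
  exists y, [/\ A y, (tau y - v) *m q = 0 & enorm (tau y - v) <= 15 * k * rho].
Proof.
move=> hp hq k0 rho0 k1 hpq lipA liptau tau_id Ax onto v vx vperp.
have n0 : 0 <= n%:R :> R by [].
have k6 : 6 * k <= 1.
  by apply: le_trans k1; rewrite ler_wpM2r//; nra.
have /choice[Y hY] : forall u, exists y, enorm (u - x) < rad ->
    A y /\ (y - u) *m p = 0.
  move=> u; have [/onto[y hy]|nu] := pselect (enorm (u - x) < rad).
    by exists y.
  by exists 0.
pose U := [set u | enorm (u - x) < rad].
have Yp u : U u -> Y u *m p = u *m p.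
  by move=> /hY[_ /eqP]; rewrite mulmxBl subr_eq0 => /eqP.
have YB u u' : U u -> U u' -> enorm (Y u - Y u') <= 2 * enorm (u - u').
  move=> Uu Uu'; have [Au _] := hY u Uu; have [Au' _] := hY u' Uu'.
  apply: le_trans (le_double_perp (_ : k <= 2^-1) (lipA _ _ Au Au')) _; first by lra.
  by rewrite mulmxBl !Yp// -mulmxBl ler_pM2l// enorm_proj.
pose psi u := tau (Y u) - u *m p.
have psi_lip u u' : U u -> U u' -> enorm (psi u - psi u') <= 4 * k * enorm (u - u').
  move=> Uu Uu'; have [Au _] := hY u Uu; have [Au' _] := hY u' Uu'.
  have -> : psi u - psi u' =
      tau (Y u) - tau (Y u') - (Y u - Y u') + perp p (Y u - Y u').
    rewrite /psi /perp mulmxBl !Yp//.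
    by apply/rowP => i; rewrite !mxE; ring.
  apply: le_trans (ler_enormD _ _) _.
  have := liptau _ _ Au Au'; have := lipA _ _ Au Au'.
  by have := ler_wpM2l k0 (YB u u' Uu Uu'); lra.
have Uv : U v by rewrite /U/=; lra.
have rad0 : 0 <= rad by have := enorm_ge0 (v - x); lra.
(* On the ball [U] the map [psi] is bounded by its norm at [v] plus its Lipschitz constant times the
   diameter. Extending it allows the fixed point to be sought in the whole space. *)
have [|||psi' [psi'E psi'_lip _]] := @lipschitz_extension _ _ U psi (4 * k)
    (enorm (psi v) + 4 * k * (2 * rad)) _ _ psi_lip.
- by rewrite mulr_ge0.
- by rewrite addr_ge0 ?enorm_ge0// !mulr_ge0.
- move=> u Uu; have -> : psi u = psi v + (psi u - psi v) by rewrite addrC subrK.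
  apply: le_trans (ler_enormD _ _) _; rewrite lerD2l.
  apply: le_trans (psi_lip u v Uu Uv) _; rewrite ler_wpM2l ?mulr_ge0//.
  have := enorm_triangle x u v; rewrite (enormB x v).
  by move: Uu Uv; rewrite /U/=; lra.
pose h z := (z *m p - z + psi' z) *m q.
have h_lip z z' : enorm (h z - h z') <= (4 * n%:R + 1) * k * enorm (z - z').
  (* The normal part [perp p (z - z')] is killed by [p], so its image by [q] is only the tilt
     between the two projections, of order [k]. This makes [h] a contraction. *)
  have -> : h z - h z' = (psi' z - psi' z') *m q -
       (perp p (z - z') *m q - perp p (z - z') *m p).
    rewrite mul_perp// subr0 /h /perp -!mulmxBl (mulmxBl z z' p).
    by congr (_ *m q); apply/rowP => i; rewrite !mxE; ring.
  apply: le_trans (ler_enormB _ _) _; rewrite (enormB (_ *m q)).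
  have h1 := enorm_proj (psi' z - psi' z') hq; have h2 := psi'_lip z z'.
  have h3 := hpq (perp p (z - z')).
  have h4 := ler_wpM2l k0 (enorm_perp (z - z') hp).
  by lra.
have [||z zE] := perturb_id_surj _ _ h_lip v.
- by rewrite mulr_ge0// addr_ge0// mulr_ge0.
- have K0 : 0 <= (4 * n%:R + 1) * k by rewrite mulr_ge0// addr_ge0// mulr_ge0.
  by move: k1 K0; rewrite -!mulrA; move: ((4 * n%:R + 1) * k) => K; nra.
have Yv : enorm (Y v - v) <= 2 * (k * rho).
  have [Av Avp] := hY v Uv; have -> : Y v - v = perp p (Y v - x) - perp p (v - x).
    by rewrite -perpB (_ : Y v - x - (v - x) = Y v - v) ?/perp ?Avp ?subr0// opprB subrKA.
  apply: le_trans (ler_enormB _ _) _; have := Ax _ Av; lra.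
have tYv : enorm (tau (Y v) - v) <= 3 * (k * rho).
  by have := enorm_triangle (Y v) (tau (Y v)) v; have := tau_id _ (hY v Uv).1; lra.
have K6 : 6 * ((4 * n%:R + 1) * k) <= 1.
  by apply: le_trans k1; rewrite -mulrA -!(mulrA 6) ler_pM2l// ler_peMl ?mulr_ge0//; lra.
have zv : enorm (z - v) <= 4 * (k * rho).
  have hv : enorm (h v) <= 3 * (k * rho).
    apply: le_trans tYv; rewrite /h psi'E// /psi (_ : v *m p - v + _ = tau (Y v) - v).
      exact: enorm_proj _ hq.
    by apply/rowP => i; rewrite !mxE; ring.
  have : enorm (z - v) <= enorm (h z - h v) + enorm (h v).
    have -> : z - v = - (h z - h v + h v) by rewrite subrK -{1}zE opprD addNKr.
    by rewrite enormN ler_enormD.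
  have := h_lip z v; have := ler_wpM2r (enorm_ge0 (z - v)) K6.
  have := mulr_ge0 k0 (ltW rho0).
  by rewrite -!mulrA; lra.
(* The fixed point stays in [U], where [psi'] is the original [psi]. *)
have Uz : U z.
  have := enorm_triangle v z x; have : k * rho <= rho / 6 by nra.
  by rewrite /U/=; lra.
have [Az _] := hY z Uz.
exists (Y z); split=> //.
  rewrite mulmxBl -zE mulmxDl /h psi'E// /psi -mulmxA hq.2 -mulmxDl.
  rewrite (_ : z + (z *m p - z + _) = tau (Y z)) ?subrr//.
  by apply/rowP => i; rewrite !mxE; ring.
have := enorm_triangle (Y z) (tau (Y z)) v; have := enorm_triangle (Y v) (Y z) v.
have := tau_id _ Az; have := YB z v Uz Uv; have := mulr_ge0 k0 (ltW rho0).
by rewrite -!mulrA; lra.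
Qed.

End ProjectionLift.

(** * Coloring of separated points and a Lipschitz partition of unity *)

Definition colors n := {ffun 'I_n -> 'I_(100 * n).+2}.

(* Points are coloured by the residues modulo [100 n + 2] of the coordinates of
   their cell in a grid of mesh [r / (2 n)]; a cell contains at most one point. *)
Lemma separated_coloring {R : realType} {n : nat} (J : Type) (x : J -> 'rV[R]_n)
    (r : R) : (0 < n)%N -> 0 < r ->
  (forall i j, i <> j -> r <= enorm (x i - x j)) ->
  exists color : J -> colors n, forall i j, color i = color j -> i <> j ->
    50 * r <= enorm (x i - x j).
Proof.
move=> n0 r0 sep; have n0R : 0 < n%:R :> R by rewrite ltr0n.
pose s := r / (2 * n%:R); have s0 : 0 < s by rewrite divr_gt0// mulr_gt0.
pose m j l := Num.floor (x j 0 l / s).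
pose K := (100 * n).+2.
exists (fun j => [ffun l => inord `|(m j l %% K%:Z)%Z|%N]).
move=> i j /ffunP eqc ij.
have {}eqc l : (m i l = m j l %[mod K%:Z])%Z.
  have K0 : K%:Z != 0 by [].
  have lt_K k : (`|(m k l %% K%:Z)%Z| < K)%N.
    by rewrite -ltz_nat gez0_abs ?modz_ge0// ltz_pmod.
  move: (eqc l); rewrite !ffunE => /(congr1 val); rewrite /= !inordK//.
  by move=> /(congr1 Posz); rewrite !gez0_abs ?modz_ge0.
have mP k l : (m k l)%:~R * s <= x k 0 l < (m k l + 1)%:~R * s.
  by rewrite -ler_pdivlMr// -ltr_pdivrMr// floor_itv.
have [eqm|] := pselect (forall l, m i l = m j l).
  have := sep _ _ ij; rewrite leNgt => /negP[].
  apply: (@le_lt_trans _ _ (n%:R * s)).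
    apply: enorm_le_coord => l; rewrite !mxE.
    have := mP i l; have := mP j l; rewrite eqm intrD => /andP[? ?] /andP[? ?].
    by rewrite ler_norml; apply/andP; split; lra.
  have -> : n%:R * s = r / 2 by rewrite /s; field; rewrite gt_eqF.
  by rewrite ltr_pdivrMr// ltr_pMr// ltr1n.
move=> /existsNP[l /eqP neqm].
suff : 50 * r <= `|(x i - x j) 0 l| by move=> /le_trans; apply; exact: ler_coord_enorm.
(* The modulus is chosen for this identity: cell indices that are distinct but equal modulo [K]
   differ by at least [K], so the coordinates differ by at least [(K - 1) * s], which exceeds
   [50 * r]. *)
have KE : (K%:R - 1) * s = 50 * r + s.
  by rewrite /K /s -natr1 -natr1 natrM; field; rewrite gt_eqF.
have far a b : (m a l < m b l)%R -> m a l = m b l %[mod K%:Z] %Z ->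
    50 * r <= x b 0 l - x a 0 l.
  move=> ltm /esym/eqP; rewrite eqz_mod_dvd => /dvdzP[q qE].
  have q1 : 1 <= q.
    rewrite leNgt; apply/negP => q1.
    have : q <= 0 by rewrite -ltzD1 add0r in q1 *.
    move=> q0; have : m b l - m a l <= 0 by rewrite qE mulr_le0_ge0.
    by rewrite subr_le0 leNgt ltm.
  have : K%:R <= (m b l)%:~R - (m a l)%:~R :> R.
    rewrite -intrB qE intrM ler_peMl//.
    by rewrite -(ler_int R) in q1.
  have := mP b l; have := mP a l; rewrite intrD => /andP[_ ha] /andP[hb _].
  by move: KE ha hb s0; nra.
rewrite !mxE; case/lt_total/orP: neqm => ltm.
- by rewrite distrC (le_trans (far _ _ ltm (eqc l)))// ler_norm.
- by rewrite (le_trans (far _ _ ltm (esym (eqc l))))// ler_norm.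
Qed.

Section WeightedAverage.
Context {R : realType} {n : nat} {J : Type} {C : finType}.
Variables (x : J -> 'rV[R]_n) (r : R) (color : J -> C).
Hypothesis r0 : 0 < r.
Hypothesis sep : forall i j, color i = color j -> i <> j ->
  50 * r <= enorm (x i - x j).
Implicit Types (y u : 'rV[R]_n) (c : C) (W : J -> 'rV[R]_n -> 'rV[R]_n).

(* The centre of colour [c] close to [y], if any: it is unique by separation,
   so that locally finite sums over [J] become sums over [C]. *)
Definition active c y : option J :=
  if pselect (exists j, color j = c /\ enorm (y - x j) < 20 * r) is left h
  then Some (projT1 (cid h)) else None.

(** A tent equal to 1 within [9 * r] of the active center and to 0 beyond [10 * r]. The jumps of
    [active], at distance [20 * r], occur where it vanishes. *)
Definition bump c y : R := if active c y is Some j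
  then Num.max 0 (Num.min 1 (10 - enorm (y - x j) / r)) else 0.

(** Dividing by the maximum with 1, rather than by the sum, keeps the weights Lipschitz where no
    center is near. *)
Definition weight c y : R := bump c y / Num.max 1 (\sum_c bump c y).

Definition average W y : 'rV[R]_n :=
  \sum_c weight c y *: (if active c y is Some j then W j y else 0).

Lemma active_some c y j : active c y = Some j ->
  color j = c /\ enorm (y - x j) < 20 * r.
Proof.
by rewrite /active; case: pselect => // h [<-]; exact: projT2 (cid h).
Qed.

Lemma activeP c y j : color j = c -> enorm (y - x j) < 20 * r ->
  active c y = Some j.
Proof.
have r_gt0 := r0.
move=> jc yj; case E : (active c y) => [i|]; last first.
  by move: E; rewrite /active; case: pselect => // -[]; exists j.
have [ic yi] := active_some E; clear E.
have [->//|ij] := pselect (i = j).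
have := sep (etrans ic (esym jc)) ij; rewrite leNgt => /negP[] {jc ic ij}.
by have := enorm_triangle y (x i) (x j); rewrite (enormB (x i) y); lra.
Qed.

Lemma bump_ge0 c y : 0 <= bump c y.
Proof. by rewrite /bump; case: active => // j; rewrite le_max lexx. Qed.

Lemma bump_le1 c y : bump c y <= 1.
Proof. by rewrite /bump; case: active => // j; rewrite ge_max ge_min lexx ler01. Qed.

Lemma bump_neq0 c y : bump c y != 0 ->
  exists j, active c y = Some j /\ enorm (y - x j) < 10 * r.
Proof.
have r_gt0 := r0.
rewrite /bump; case: active => [j|]; last by rewrite eqxx.
move=> h; exists j; split=> //; rewrite -ltr_pdivrMr// ltNge.
apply: contra h => h; rewrite max_l// ge_min; apply/orP; right; lra.
Qed.

(** A point with nonzero bump is within [10 * r] of its center, so a point at distance less than [r]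
    from it is within [11 * r], where the same center is still active. This alternative reduces the
    Lipschitz estimates to one fixed center per color. *)
Lemma bump_pair c y y' : enorm (y - y') < r ->
  (bump c y = 0 /\ bump c y' = 0) \/
  exists j, [/\ active c y = Some j, active c y' = Some j,
    enorm (y - x j) < 12 * r & enorm (y' - x j) < 12 * r].
Proof.
have r_gt0 := r0.
move=> yy'.
have [/eqP by0|/bump_neq0[j [ay yj]]] := boolP (bump c y == 0).
  have [/eqP by'0|/bump_neq0[j [ay yj]]] := boolP (bump c y' == 0); first by left.
  right; exists j; have [jc _] := active_some ay.
  have yj' : enorm (y - x j) < 12 * r.
    by have := enorm_triangle y' y (x j); lra.
  by split=> //; [apply: activeP => //; lra | lra].
right; exists j; have [jc _] := active_some ay.
have yj' : enorm (y' - x j) < 12 * r.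
  by have := enorm_triangle y y' (x j); rewrite (enormB y' y); lra.
by split=> //; [apply: activeP => //; lra | lra].
Qed.

Lemma norm_clamp01B (a b : R) :
  `|Num.max 0 (Num.min 1 a) - Num.max 0 (Num.min 1 b)| <= `|a - b|.
Proof.
wlog ab : a b / a <= b => [hw|].
  by case: (leP a b) => [/hw//|/ltW/hw]; rewrite distrC (distrC b).
rewrite (ler0_norm (_ : a - b <= 0)) ?subr_le0// ler_norml; apply/andP.
by case: (leP 1 a) => ?; case: (leP 1 b) => ?; rewrite ?(max_r ler01);
  case: (leP 0 a) => ?; case: (leP 0 b) => ?; split; lra.
Qed.

Lemma bump_lip c y y' : enorm (y - y') < r ->
  `|bump c y - bump c y'| <= enorm (y - y') / r.
Proof.
move=> yy'; have [[-> ->]|[j [ay ay' _ _]]] := bump_pair c yy'.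
  by rewrite subrr normr0 divr_ge0 ?enorm_ge0// ltW.
rewrite /bump ay ay'.
apply: le_trans (norm_clamp01B _ _) _.
have -> : 10 - enorm (y - x j) / r - (10 - enorm (y' - x j) / r) =
    (enorm (y' - x j) - enorm (y - x j)) * r^-1 by ring.
rewrite normrM (gtr0_norm (_ : 0 < r^-1)) ?invr_gt0//.
rewrite ler_wpM2r ?invr_ge0 ?(ltW r0)// ler_norml.
have := enorm_triangle y y' (x j); have := enorm_triangle y' y (x j).
by rewrite (enormB y' y) => ? ?; apply/andP; split; lra.
Qed.

Let total y : R := Num.max 1 (\sum_c bump c y).

Let total_ge1 y : 1 <= total y.
Proof. by rewrite le_max lexx. Qed.

Let total_lip y y' : enorm (y - y') < r ->
  `|total y - total y'| <= #|C|%:R * (enorm (y - y') / r).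
Proof.
move=> yy'.
have : `|\sum_c bump c y - \sum_c bump c y'| <= #|C|%:R * (enorm (y - y') / r).
  rewrite -sumrB (le_trans (ler_norm_sum _ _ _))//.
  rewrite mulr_natl -sumr_const; apply: ler_sum => c _; exact: bump_lip.
rewrite /total; move: (\sum_c _) (\sum_c _) (_ * _) => a b e.
rewrite !ler_norml => /andP[? ?].
by case: (leP 1 a) => ?; case: (leP 1 b) => ?; apply/andP; split; lra.
Qed.

Lemma weight_ge0 c y : 0 <= weight c y.
Proof. by rewrite divr_ge0 ?bump_ge0// (le_trans ler01 (total_ge1 y)). Qed.

Lemma weight_sum_le1 y : \sum_c weight c y <= 1.
Proof.
rewrite -mulr_suml ler_pdivrMr ?mul1r ?le_max ?lexx ?orbT//.
exact: lt_le_trans ltr01 (total_ge1 y).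
Qed.

Lemma weight_sum1 y j : enorm (y - x j) <= 9 * r -> \sum_c weight c y = 1.
Proof.
have r_gt0 := r0.
move=> yj; rewrite -mulr_suml.
have h : 1 <= \sum_c bump c y.
  rewrite (bigD1 (color j))//= (le_trans _ (ler_wpDr _ (lexx _)))//.
    rewrite /bump (@activeP _ _ j)//; last by lra.
    rewrite le_max le_min lexx/=; apply/orP; right.
    by move: yj; rewrite -ler_pdivrMr//; lra.
  by apply: sumr_ge0 => c _; exact: bump_ge0.
by rewrite max_r// divff// gt_eqF// (lt_le_trans ltr01 h).
Qed.

Lemma weight_lip c y y' : enorm (y - y') < r ->
  `|weight c y - weight c y'| <= (#|C|%:R + 1) * (enorm (y - y') / r).
Proof.
move=> yy'; have h1 := bump_lip c yy'; have h2 := total_lip yy'.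
have t1 := total_ge1 y; have t1' := total_ge1 y'.
have b0 := bump_ge0 c y'; have b1 := bump_le1 c y'.
rewrite /weight -/(total y) -/(total y').
move: (total y) (total y') (bump c y) (bump c y') h1 h2 t1 t1' b0 b1.
move=> t t' b b' h1 h2 t1 t1' b0 b1.
(* Both terms are controlled since [t >= 1] and [b' / t'] lies between 0 and 1. *)
have -> : b / t - b' / t' = (b - b') / t + b' / t' * ((t' - t) / t).
  by field; rewrite !gt_eqF//; lra.
have ht a : `|a / t| <= `|a|.
  rewrite normrM normfV (ger0_norm (_ : 0 <= t)); last by lra.
  by rewrite ler_pdivrMr ?ler_peMr//; lra.
apply: le_trans (ler_normD _ _) _; rewrite [leRHS]mulrDl mul1r [leRHS]addrC.
apply: lerD; first exact: le_trans h1.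
rewrite (le_trans _ h2)// (distrC t) normrM -[leRHS]mul1r ler_pM//.
by rewrite ger0_norm ?divr_ge0// ?ler_pdivrMr; lra.
Qed.

Lemma average_bound W y a : 0 <= a ->
  (forall j, enorm (y - x j) < 12 * r -> enorm (W j y) <= a) ->
  enorm (average W y) <= a.
Proof.
move=> a0 hW; apply: le_trans (enorm_sum _ _ _) _.
apply: (@le_trans _ _ (\sum_c weight c y * a)).
  apply: ler_sum => c _; rewrite enormZ ger0_norm ?weight_ge0//.
  have [/eqP b0|/bump_neq0[j [-> yj]]] := boolP (bump c y == 0).
    by rewrite /weight b0 !mul0r.
  by rewrite ler_wpM2l ?weight_ge0// hW//; have := r0; lra.
by rewrite -mulr_suml ler_piMl// weight_sum_le1.
Qed.

(** For points closer than [r], the Leibniz rule is applied color by color: the weight contributes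
    [#|C| + 1], its slope of order [1 / r] meeting vectors of size [a * r], and the vectors
    contribute 1. For points further apart the two size bounds suffice, whence the final 2. *)
Lemma average_lip W y y' a : 0 <= a ->
  (forall j, enorm (y - x j) < 12 * r -> enorm (W j y) <= a * r) ->
  (forall j, enorm (y' - x j) < 12 * r -> enorm (W j y') <= a * r) ->
  (forall j, enorm (y - x j) < 12 * r -> enorm (y' - x j) < 12 * r ->
     enorm (W j y - W j y') <= a * enorm (y - y')) ->
  enorm (average W y - average W y') <=
    (#|C|%:R * (#|C|%:R + 2) + 2) * a * enorm (y - y').
Proof.
move=> a0 hy hy' hyy'; set N : R := #|C|%:R.
have N0 : 0 <= N by [].
have e0 := enorm_ge0 (y - y').
have ae0 : 0 <= a * enorm (y - y') by rewrite mulr_ge0.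
have [yy'|yy'] := ltP (enorm (y - y')) r; last first.
  have ar0 : 0 <= a * r by rewrite mulr_ge0// ltW.
  apply: le_trans (ler_enormB _ _) _.
  have := average_bound ar0 hy; have := average_bound ar0 hy'.
  have := ler_wpM2l a0 yy'; have : 0 <= N * (N + 2) by rewrite mulr_ge0// addr_ge0.
  by rewrite -!mulrA; nra.
apply: (@le_trans _ _ (N * ((N + 2) * (a * enorm (y - y'))))); last first.
  by rewrite !mulrA ler_wpM2r// ler_wpM2r// lerDl.
rewrite /average -sumrB (le_trans (enorm_sum _ _ _))//.
rewrite /N mulr_natl -sumr_const; apply: ler_sum => c _.
have [[b0 b0']|[j [-> -> yj yj']]] := bump_pair c yy'.
  by rewrite /weight b0 b0' !mul0r !scale0r subrr enorm0 mulr_ge0// addr_ge0.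
have -> : weight c y *: W j y - weight c y' *: W j y' =
    (weight c y - weight c y') *: W j y + weight c y' *: (W j y - W j y').
  by apply/rowP => i; rewrite !mxE; ring.
apply: le_trans (ler_enormD _ _) _; rewrite !enormZ.
have w1 : `|weight c y'| <= 1.
  rewrite ger0_norm ?weight_ge0// (le_trans _ (weight_sum_le1 y'))//.
  by rewrite (bigD1 c)//= lerDl sumr_ge0// => *; exact: weight_ge0.
have -> : (N + 2) * (a * enorm (y - y')) =
    (N + 1) * (enorm (y - y') / r) * (a * r) + 1 * (a * enorm (y - y')).
  by field; rewrite gt_eqF.
by rewrite lerD// ler_pM ?enorm_ge0// ?weight_lip ?hy ?hyy'.
Qed.

Lemma average_eq0 W y : (forall j, 10 * r <= enorm (y - x j)) -> average W y = 0.
Proof.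
move=> far; apply: big1 => c _.
have [/eqP b0|/bump_neq0[j [_ yj]]] := boolP (bump c y == 0).
  by rewrite /weight b0 mul0r scale0r.
by have := far j; rewrite leNgt yj.
Qed.

(** Near a center the weights add up to 1, so the fixed vector [u] can be distributed over the
    average. This makes the cancellation of normal components visible term by term. *)
Lemma perp_average p u W y j : enorm (y - x j) <= 9 * r ->
  perp p (u + average W y) = average (fun j y => perp p (u + W j y)) y.
Proof.
move=> yj; rewrite -[u in LHS]scale1r -(weight_sum1 yj) scaler_suml -big_split.
rewrite perp_sum; apply: eq_bigr => c _ /=; rewrite -scalerDr perpZ.
have [/eqP b0|/bump_neq0[k [-> _]]] := boolP (bump c y == 0) => //.
by rewrite /weight b0 mul0r !scale0r.
Qed.

End WeightedAverage.

Section Radius.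
Context {R : realType}.

Lemma radius_gt0 k : 0 < radius k :> R.
Proof. by rewrite /radius invr_gt0 exprn_gt0. Qed.

Lemma radiusS k : radius k.+1 = radius k / 10 :> R.
Proof. by rewrite /radius exprS invfM mulrC. Qed.

Lemma radius_0 : radius 0 = 1 :> R.
Proof. by rewrite /radius expr0 invr1. Qed.

Lemma radius_le1 k : radius k <= 1 :> R.
Proof. by rewrite /radius invf_le1 ?exprn_gt0// exprn_ege1// ler1n. Qed.

Lemma radius_add k m : radius (k + m) = radius k * radius m :> R.
Proof. by rewrite /radius exprD invfM. Qed.

End Radius.

(** * One step of the construction *)

Definition close_planes {R : realType} {n : nat} (p : 'M[R]_n) (x : 'rV[R]_n)
    (q : 'M[R]_n) (y : 'rV[R]_n) (delta r : R) : Prop :=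
  [/\ forall u, enorm (u *m p - u *m q) <= delta * enorm u,
      enorm (perp p (y - x)) <= delta * r &
      enorm (perp q (y - x)) <= delta * r].

Section Step.
Context {R : realType} {n : nat} (J : nat -> Type).
Variables (x : forall k, J k -> 'rV[R]_n) (p : forall k, J k -> 'M[R]_n).
Arguments x {k}.
Arguments p {k}.
Implicit Types (u v w y z : 'rV[R]_n) (S : set 'rV[R]_n).

(** The axioms on balls and planes, restated for projections with one parameter for tilts and
    offsets. The range 50 is half that of the axiom because the comparison of two planes in a ball
    wants both base points in the half ball. *)
Record coherent (delta : R) : Prop := Coherent {
  coh_proj : forall k (j : J k), orthoproj (p j);
  coh_sep : forall k (i j : J k), i <> j -> radius k <= enorm (x i - x j);
  coh_near : forall k (j : J k.+1), exists i : J k,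
    enorm (x j - x i) < 2 * radius k;
  coh_same : forall k (i j : J k), enorm (x i - x j) <= 50 * radius k ->
    close_planes (p i) (x i) (p j) (x j) delta (radius k);
  coh_next : forall k (i : J k) (j : J k.+1),
    enorm (x i - x j) <= 2 * radius k ->
    close_planes (p i) (x i) (p j) (x j) delta (radius k)
}.

(* The bound in [flat_base] leaves room for all later displacements, and keeps
   [S] away from the points at distance 2 from [S0], which must not move. *)
Record flat_at (a : R) (S0 : set 'rV[R]_n) k S : Prop := FlatAt {
  flat_near : forall (j : J k) y, S y -> enorm (y - x j) < 30 * radius k ->
    enorm (perp (p j) (y - x j)) <= a * radius k;
  flat_lip : forall (j : J k) y y', S y -> S y' ->
    enorm (y - x j) < 30 * radius k -> enorm (y' - x j) < 30 * radius k ->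
    enorm (perp (p j) (y - y')) <= a * enorm (y - y');
  flat_onto : forall (j : J k) v, enorm (v - x j) < 20 * radius k ->
    exists y, [/\ S y, enorm (y - x j) < 25 * radius k & (y - v) *m p j = 0];
  flat_base : forall s, S s -> exists2 s0, S0 s0 &
    enorm (s - s0) <= (1 - radius k) / 2
}.

(** The factor of [average_lip] for the colors in use; it depends on the dimension only. *)
Let Q : R := #|colors n|%:R * (#|colors n|%:R + 2) + 2.

Let Q_ge2 : 2 <= Q.
Proof. by rewrite /Q lerDr mulr_ge0// addr_ge0. Qed.

Section OneGeneration.
Variables (k : nat) (color : J k -> colors n).
Let r : R := radius k.

(* Where the weights add up to 1, [y + displacement y] is the average of the
   projections of [y] on the nearby planes. *)
Definition displacement y : 'rV[R]_n :=
  average (@x k) r color (fun j y => - perp (p j) (y - x j)) y.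

Definition separated_colors : Prop :=
  forall i j, color i = color j -> i <> j -> 50 * r <= enorm (x i - x j).

Lemma displacement_bound a S0 S y : separated_colors -> flat_at a S0 k S -> 0 <= a ->
  S y -> enorm (displacement y) <= a * r.
Proof.
move=> sep [near _ _ _] a0 Sy; have r0 : 0 < r := radius_gt0 k.
apply: average_bound => //; first by rewrite mulr_ge0// ltW.
by move=> j yj; rewrite enormN near//; apply: lt_trans yj _; rewrite -/r; lra.
Qed.

Lemma displacement_lip a S0 S y y' : separated_colors -> flat_at a S0 k S -> 0 <= a ->
  S y -> S y' ->
  enorm (displacement y - displacement y') <= Q * a * enorm (y - y').
Proof.
move=> sep [near lip _ _] a0 Sy Sy'; have r0 : 0 < r := radius_gt0 k.
have h12 u (j : J k) : enorm (u - x j) < 12 * r -> enorm (u - x j) < 30 * r by lra.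
apply: average_lip => // [j yj|j yj|j yj yj'].
- by rewrite enormN near//; exact: h12.
- by rewrite enormN near//; exact: h12.
- rewrite -opprD enormN -perpB (_ : y - x j - (y' - x j) = y - y').
    by apply: (lip j) => //; exact: h12.
  by rewrite opprB addrA subrK.
Qed.

Lemma displacement_far y : separated_colors ->
  (forall j : J k, 10 * r <= enorm (y - x j)) -> displacement y = 0.
Proof. by move=> sep; apply: average_eq0 => //; exact: radius_gt0. Qed.

Lemma perp_displacement (i : J k) y : separated_colors -> enorm (y - x i) <= 9 * r ->
  perp (p i) (y + displacement y - x i) =
  average (@x k) r color
    (fun (j : J k) y => perp (p i) (y - x i - perp (p j) (y - x j))) y.
Proof.
move=> sep yi; rewrite addrAC /displacement.
rewrite (@perp_average _ _ _ _ (@x k) r color (radius_gt0 k) sep _ _ _ _ i yi).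
by [].
Qed.

(** The vector [y - perp (p j) (y - x j)] is the projection of [y] on plane [j], so the flatness
    constant drops out: tilting a vector of length at most [12 * r] costs [12 * delta * r], and the
    offset of the two planes [delta * r]. *)
Lemma perp_relative_offset delta (i j : J k) y : coherent delta -> 0 <= delta ->
  enorm (y - x i) < 6 * r -> enorm (y - x j) < 12 * r ->
  enorm (perp (p i) (y - x i - perp (p j) (y - x j))) <= 13 * delta * r.
Proof.
move=> coh delta0 yi yj; have r0 : 0 < r := radius_gt0 k.
have pj := coh_proj coh j.
have [|hpq _ _] := coh_same coh (i := j) (j := i).
  by have := enorm_triangle y (x j) (x i); rewrite (enormB (x j) y) -/r; lra.
have [|_ off _] := coh_same coh (i := i) (j := j).
  by have := enorm_triangle y (x i) (x j); rewrite (enormB (x i) y) -/r; lra.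
have -> : y - x i - perp (p j) (y - x j) = (y - x j) *m p j + (x j - x i).
  by rewrite {1}/perp; apply/rowP => l; rewrite !mxE; ring.
rewrite perpD (le_trans (ler_enormD _ _))//.
have : enorm (perp (p i) ((y - x j) *m p j)) <= delta * (12 * r).
  have := hpq ((y - x j) *m p j); rewrite -mulmxA pj.2 => /le_trans; apply.
  by rewrite ler_wpM2l// (le_trans (enorm_proj _ pj))// ltW.
by move: off; rewrite -/r; lra.
Qed.

Lemma displacement_flat delta (i : J k) y : separated_colors -> coherent delta ->
  0 <= delta -> enorm (y - x i) < 6 * r ->
  enorm (perp (p i) (y + displacement y - x i)) <= 13 * delta * r.
Proof.
move=> sep coh delta0 yi; have r0 : 0 < r := radius_gt0 k.
rewrite perp_displacement//; last by lra.
apply: average_bound => //; first by rewrite !mulr_ge0// ltW.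
by move=> j yj; exact: perp_relative_offset.
Qed.

(** The same cancellation for increments: each summand varies like the component normal to plane [i]
    of a vector parallel to plane [j]. *)
Lemma displacement_flat_lip delta (i : J k) y y' : separated_colors ->
  coherent delta -> 0 <= delta ->
  enorm (y - x i) < 6 * r -> enorm (y' - x i) < 6 * r ->
  enorm (perp (p i) (y + displacement y - (y' + displacement y'))) <=
    Q * (13 * delta) * enorm (y - y').
Proof.
move=> sep coh delta0 yi yi'; have r0 : 0 < r := radius_gt0 k.
have -> : y + displacement y - (y' + displacement y') =
    y + displacement y - x i - (y' + displacement y' - x i).
  by apply/rowP => l; rewrite !mxE; ring.
rewrite perpB !perp_displacement//; [|lra|lra].
apply: average_lip => // [|j yj|j yj|j yj yj'].
- by rewrite mulr_ge0.
- exact: perp_relative_offset.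
- exact: perp_relative_offset.
have [|hpq _ _] := coh_same coh (i := j) (j := i).
  by have := enorm_triangle y (x j) (x i); rewrite (enormB (x j) y) -/r; lra.
have -> : perp (p i) (y - x i - perp (p j) (y - x j)) -
    perp (p i) (y' - x i - perp (p j) (y' - x j)) = perp (p i) ((y - y') *m p j).
  rewrite -perpB; congr perp; rewrite /perp !mulmxBl.
  by apply/rowP => l; rewrite !mxE; ring.
have pj := coh_proj coh j.
have := hpq ((y - y') *m p j); rewrite -mulmxA pj.2 => /le_trans; apply.
rewrite -mulrA (le_trans (ler_wpM2l delta0 (enorm_proj _ pj)))//.
by have := mulr_ge0 delta0 (enorm_ge0 (y - y')); lra.
Qed.

End OneGeneration.

Lemma perp_le_close (q q' : 'M[R]_n) (delta : R) u :
  enorm (u *m q - u *m q') <= delta * enorm u ->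
  enorm (perp q' u) <= enorm (perp q u) + delta * enorm u.
Proof.
move=> h; have -> : perp q' u = perp q u + (u *m q - u *m q').
  by rewrite /perp; apply/rowP => l; rewrite !mxE; ring.
by rewrite (le_trans (ler_enormD _ _))// lerD2l.
Qed.

(** The induction closes because the new normal components involve only [delta]: at most
    [21 * delta * r] for positions, to be compared with [a * r / 10] at the next scale, and
    [(26 * Q + 1) * delta] for slopes. The last numerical condition serves [projection_lift] and
    makes [eta] at most 1/60. *)
Lemma exists_step delta a k S0 S : (0 < n)%N -> coherent delta -> 0 <= delta ->
  flat_at a S0 k S -> 23 * Q * delta <= a / 10 ->
  60 * (n%:R + 1) * (4 * n%:R + 1) * (n%:R * Q * a) <= 1 ->
  exists h : 'rV[R]_n -> 'rV[R]_n,
  [/\ forall z z', enorm (h z - h z') <= n%:R * Q * a * enorm (z - z'),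
      forall z, enorm (h z) <= n%:R * Q * a * radius k,
      forall z, (forall s, S0 s -> 2 <= enorm (z - s)) -> h z = 0,
      forall y, S y -> (forall j : J k, 10 * radius k <= enorm (y - x j)) -> h y = 0 &
      flat_at a S0 k.+1 [set z + h z | z in S]].
Proof.
move=> n0 coh delta0 flatS a_ge eta_le; have Q2 := Q_ge2.
set eta := n%:R * Q * a in eta_le *.
set r := radius k; have r0 : 0 < r := radius_gt0 k.
have r1 : r <= 1 := radius_le1 k.
have n1 : 1 <= n%:R :> R by rewrite ler1n.
have Qd : 0 <= Q * delta by rewrite mulr_ge0//; lra.
have delta_a : 22 * delta <= a / 10 by nra.
have a0 : 0 <= a by lra.
have {}a_ge : (26 * Q + 1) * delta <= a by lra.
have Qa0 : 0 <= Q * a by rewrite mulr_ge0//; lra.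
have a_eta : a <= eta.
  rewrite /eta -mulrA; apply: (@le_trans _ _ (Q * a)); last by rewrite ler_peMl.
  by rewrite ler_peMl//; lra.
have eta0 : 0 <= eta by lra.
have eta_small : 60 * eta <= 1.
  apply: le_trans eta_le; rewrite ler_wpM2r//; nra.
have [color sep] := separated_coloring n0 r0 (coh_sep coh (k:=k)).
pose Z := [set z | forall s, S0 s -> 2 <= enorm (z - s)].
(* The extension starts from [S] and [Z] together, with value 0 on [Z]. This is compatible with the
   Lipschitz bound because [S] stays within 1/2 of [S0], hence at distance at least 1 from [Z]. *)
pose f y := if pselect (Z y) then 0 else displacement color y.
have SnZ y : S y -> Z y -> False.
  move=> /(flat_base flatS)[s S0s ys] /(_ s S0s).
  by rewrite leNgt => /negP[]; move: ys; rewrite -/r; lra.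
have fS y : S y -> f y = displacement color y.
  by move=> Sy; rewrite /f; case: pselect => // Zy; case: (SnZ y Sy Zy).
have fZ z : Z z -> f z = 0 by move=> Zz; rewrite /f; case: pselect.
have f_bound z : (S `|` Z) z -> enorm (f z) <= a * r.
  move=> [Sz|Zz]; last by rewrite fZ// enorm0 mulr_ge0// ltW.
  by rewrite fS//; exact: displacement_bound flatS a0 Sz.
have SZ y z : S y -> Z z -> 1 <= enorm (y - z).
  move=> /(flat_base flatS)[s S0s ys] /(_ s S0s) zs.
  have := enorm_triangle y z s; rewrite (enormB z y).
  by move: ys; rewrite -/r; lra.
have aL (e : R) : 1 <= e -> a * r <= Q * a * e.
  move=> e1; apply: le_trans (_ : a * r <= a) _; first by rewrite ler_piMr.
  apply: (@le_trans _ _ (Q * a)); last by rewrite ler_peMr.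
  by rewrite ler_peMl//; lra.
have f_lip y z : (S `|` Z) y -> (S `|` Z) z ->
    enorm (f y - f z) <= Q * a * enorm (y - z).
  move=> [Sy|Zy] [Sz|Zz].
  - by rewrite !fS//; exact: displacement_lip flatS a0 Sy Sz.
  - rewrite (fZ z)// subr0 (le_trans (f_bound _ _))//; first by left.
    exact/aL/SZ.
  - rewrite (fZ y)// sub0r enormN (le_trans (f_bound _ _))//; first by left.
    by rewrite enormB; exact/aL/SZ.
  - by rewrite !fZ// subr0 enorm0 mulr_ge0 ?enorm_ge0.
have ar0 : 0 <= a * r by rewrite mulr_ge0// ltW.
have [h [hf h_lip h_bound]] := lipschitz_extension Qa0 ar0 f_lip f_bound.
have hS y : S y -> h y = displacement color y by move=> Sy; rewrite hf ?fS//; left.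
have {}h_lip z z' : enorm (h z - h z') <= eta * enorm (z - z').
  by rewrite /eta -(mulrA n%:R).
have {}h_bound z : enorm (h z) <= eta * r.
  apply: le_trans (h_bound z) _; rewrite mulrA ler_wpM2r//; first exact: ltW.
  by rewrite /eta -mulrA ler_wpM2l// ler_peMl//; lra.
exists h; split => //.
- by move=> z Zz; rewrite hf ?fZ//; right.
- by move=> y Sy far; rewrite hS// displacement_far.
have er : eta * r <= r / 60 by nra.
have rS : radius k.+1 = r / 10 :> R by rewrite radiusS.
have small6 : 6 * (n%:R + 1) * (4 * n%:R + 1) * eta <= 1.
  apply: le_trans eta_le; rewrite ler_wpM2r//.
  have n11 : 0 <= (n%:R + 1) * (4 * n%:R + 1) :> R by rewrite mulr_ge0//; lra.
  by rewrite -!mulrA; lra.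
clear eta_le Qa0 ar0 Q2 n1 r1 f_bound f_lip SZ aL SnZ.
(* A moved point within [3 * r] of [x j], itself within [2 * r] of its parent [x i], comes from a
   point within [6 * r] of [x i], the range of [displacement_flat]. *)
have near_parent y (j : J k.+1) (i : J k) : enorm (x j - x i) < 2 * r ->
    enorm (y + h y - x j) < 30 * radius k.+1 -> enorm (y - x i) < 6 * r.
  rewrite rS => ji yj.
  have := enorm_triangle (y + h y) y (x i); have := enorm_triangle (x j) (y + h y) (x i).
  by rewrite opprD addNKr enormN; have := h_bound y; lra.
split.
- move=> j _ [y Sy <-] yj; have [i] := coh_near coh j; rewrite -/r => ji.
  have yi := near_parent y j i ji yj.
  have [|hpq _ off] := coh_next coh (i := i) (j := j); first by rewrite enormB ltW.
  clear small6 eta_small a_ge a_eta eta0 Qd.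
  have zi := displacement_flat sep coh delta0 yi; rewrite -hS// -/r in zi.
  have -> : y + h y - x j = (y + h y - x i) - (x j - x i) by rewrite opprB addrA subrK.
  rewrite perpB (le_trans (ler_enormB _ _))//.
  have := perp_le_close (hpq (y + h y - x i)).
  have : enorm (y + h y - x i) <= 7 * r.
    by rewrite addrAC (le_trans (ler_enormD _ _))//; have := h_bound y; lra.
  move: off; rewrite -/r rS => off /(ler_wpM2l delta0) h7 hz.
  have : 22 * delta * r <= a / 10 * r by rewrite ler_wpM2r//; exact: ltW.
  have : 0 <= delta * r by rewrite mulr_ge0//; exact: ltW.
  by move: h7 hz zi off; lra.
- move=> j _ _ [y Sy <-] [y' Sy' <-] yj yj'; have [i] := coh_near coh j; rewrite -/r => ji.
  have yi := near_parent y j i ji yj; have yi' := near_parent y' j i ji yj'.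
  have [|hpq _ off] := coh_next coh (i := i) (j := j); first by rewrite enormB ltW.
  clear small6 delta_a a_eta er.
  have zi := displacement_flat_lip sep coh delta0 yi yi'; rewrite -!hS// in zi.
  apply: le_trans (perp_le_close (hpq _)) _.
  have := perturb_id_ge (h_lip y y').
  set e := enorm (y - y') in zi *; set e' := enorm (y + h y - (y' + h y')).
  have e0 : 0 <= e := enorm_ge0 _; have e'0 : 0 <= e' := enorm_ge0 _.
  (* Slopes are relative to the distance of the images. The step at most halves distances, which
     turns [13 * Q] into [26 * Q]. *)
  move=> ee'; have {}ee' : e <= 2 * e' by nra.
  have h1 : Q * delta * e <= Q * delta * (2 * e') by rewrite ler_wpM2l.
  have h2 : (26 * Q + 1) * delta * e' <= a * e' by rewrite ler_wpM2r.
  have h3 : 0 <= delta * e' by rewrite mulr_ge0.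
  lra.
- move=> j v vj; have [i] := coh_near coh j; rewrite -/r => ji.
  have [|hpq off _] := coh_next coh (i := i) (j := j); first by rewrite enormB ltW.
  clear a_ge Qd eta_small.
  (* The point [v] may be far from both planes. The lift is built for its projection on plane [j],
     which is also close to plane [i] and which [p j] does not distinguish from [v]. *)
  pose v' := x j + (v - x j) *m p j.
  have pj := coh_proj coh j; have pi := coh_proj coh i.
  have v'j : enorm (v' - x j) < 2 * r.
    rewrite /v' addrAC subrr add0r; apply: le_lt_trans (enorm_proj _ pj) _.
    by move: vj; rewrite rS; lra.
  pose A := [set y | S y /\ enorm (y - x i) < 25 * r].
  have lip1 := flat_lip flatS.
  have [y [[Sy yi] yv yv']] : exists y, [/\ A y, (y + h y - v') *m p j = 0 &
      enorm (y + h y - v') <= 15 * eta * r].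
    apply: (@projection_lift _ _ A (p i) (p j) (fun y => y + h y) (x i) eta r (20 * r)).
    - exact: pi.
    - exact: pj.
    - exact: eta0.
    - exact: r0.
    - exact: small6.
    - by move=> u; apply: le_trans (hpq u) _; rewrite ler_wpM2r ?enorm_ge0//; lra.
    - move=> y y' [Sy yi] [Sy' yi']; apply: (@le_trans _ _ (a * enorm (y - y'))).
        by apply: (flat_lip flatS (j := i)) => //; rewrite -/r; lra.
      by rewrite ler_wpM2r ?enorm_ge0.
    - move=> y y' _ _; rewrite (_ : _ - _ = h y - h y')//.
      by apply/rowP => l; rewrite !mxE; ring.
    - by move=> y _; rewrite addrAC subrr add0r.
    - move=> y [Sy yi]; apply: (@le_trans _ _ (a * r)); last by rewrite ler_wpM2r//; exact: ltW.
      by apply: (flat_near flatS) => //; rewrite -/r; lra.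
    - by move=> u /(flat_onto flatS)[y [Sy yi yu]]; exists y.
    - by have := enorm_triangle (x j) v' (x i); lra.
    - have -> : v' - x i = (v - x j) *m p j + (x j - x i).
        by rewrite /v'; apply/rowP => l; rewrite !mxE; ring.
      rewrite perpD (le_trans (ler_enormD _ _))//.
      have h1 : enorm (perp (p i) ((v - x j) *m p j)) <= delta * (2 * r).
        have := perp_le_close (q := p j) (q' := p i) (delta := delta) (u := (v - x j) *m p j).
        rewrite perp_mul// enorm0 add0r => /(_ _)/le_trans; apply.
          by rewrite enormB; exact: hpq.
        rewrite ler_wpM2l// (le_trans (enorm_proj _ pj))// ltW//.
        by move: vj; rewrite rS; lra.
      have h2 : 22 * delta * r <= eta * r by rewrite ler_wpM2r//; [exact: ltW | lra].
      have : 0 <= delta * r by rewrite mulr_ge0//; exact: ltW.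
      by move: off; rewrite -/r; lra.
  exists (y + h y); split; first by exists y.
  - by have := enorm_triangle v' (y + h y) (x j); rewrite rS; lra.
  - have -> : y + h y - v = y + h y - v' + (v' - v) by rewrite addrA subrK.
    rewrite mulmxDl yv add0r /v'.
    have -> : x j + (v - x j) *m p j - v = (v - x j) *m p j - (v - x j).
      by apply/rowP => l; rewrite !mxE; ring.
    by rewrite mulmxBl -mulmxA pj.2 subrr.
(* The allowance grows by [9 * r / 20] between the two generations, more than the displacement,
   which is at most [r / 60]. *)
- move=> _ [y /(flat_base flatS)[s S0s ys] <-]; exists s => //.
  clear small6 eta_small a_ge a_eta eta0 Qd delta_a delta0 a0.
  by rewrite addrAC (le_trans (ler_enormD _ _))//; have := h_bound y;
    move: ys; rewrite -/r rS; lra.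
Qed.

End Step.

(** * Affine planes and their local distances *)

Definition plane_at {R : realType} {n : nat} (p : 'M[R]_n) (z : 'rV[R]_n) :
  set 'rV[R]_n := [set y | perp p (y - z) = 0].

Section Planes.
Context {R : realType} {n : nat}.
Implicit Types (u v w x y z : 'rV[R]_n) (p q : 'M[R]_n) (P : set 'rV[R]_n).

Lemma affine_plane_proj d P x : affine_plane d P -> P x ->
  exists p, [/\ orthoproj p, P = plane_at p x & forall z, affine_plane d (plane_at p z)].
Proof.
move=> [x0 [V [dV ->]]] /= xV; have [p [hp pV]] := exists_orthoproj V.
have perpV v : (perp p v = 0) = (v \in V : Prop).
  apply/propext; rewrite pV /perp; split=> [/eqP|/eqP E]; first by rewrite subr_eq0 eq_sym.
  by rewrite E subrr.
exists p; split=> //.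
  apply/seteqP; split=> y; rewrite /plane_at/= perpV => yV.
    have -> : y - x = y - x0 - (x - x0) by rewrite opprB addrA subrK.
    exact: rpredB.
  have -> : y - x0 = y - x + (x - x0) by rewrite addrA subrK.
  exact: rpredD.
move=> z; exists z, V; split=> //.
by apply/seteqP; split=> y; rewrite /plane_at/= perpV.
Qed.

Lemma plane_at_mul p x u : orthoproj p -> plane_at p x (x + u *m p).
Proof. by move=> hp; rewrite /plane_at/= addrAC subrr add0r perp_mul. Qed.

Lemma set_dist_plane p x y (c : R) : orthoproj p ->
  (set_dist y (plane_at p x) <= c%:E)%E -> enorm (perp p (y - x)) <= c.
Proof.
move=> hp; rewrite -lee_fin; apply: le_trans; apply/ereal_infP => _ [z pz <-].
rewrite lee_fin (_ : perp p (y - x) = perp p (y - z)) ?enorm_perp//.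
by rewrite -[RHS]addr0 -[0 in RHS]pz -perpD addrA subrK.
Qed.

Lemma local_dist_le z (rho e : R) E F y : 0 < rho ->
  (local_dist z rho E F <= e%:E)%E -> E y -> enorm (y - z) < rho ->
  (set_dist y F <= (e * rho)%:E)%E.
Proof.
move=> rho0; rewrite /local_dist => h Ey yz.
have : (set_dist y F <= maxe (ereal_sup [set set_dist y F | y in E `&` eball z rho])
                    (ereal_sup [set set_dist y E | y in F `&` eball z rho]))%E.
  by rewrite le_max; apply/orP; left; apply: ereal_sup_ubound; exists y.
move/le_trans; apply.
by rewrite lee_pdivrMl// -EFinM mulrC in h.
Qed.

Lemma local_dist_sym z (rho : R) E F : local_dist z rho E F = local_dist z rho F E.
Proof. by rewrite /local_dist maxC. Qed.

(** The distance estimate is applied to [x] and to [x + t v], where [v] is parallel to the first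
    plane and [t v] has length [rho / 4]; both points are in the ball. Subtracting, a vector of
    length [rho / 4] has normal part at most [2 * e * rho], whence the 8. *)
Lemma local_dist_perp p q x y z (rho e : R) : orthoproj p -> orthoproj q -> 0 < rho ->
  (local_dist z rho (plane_at p x) (plane_at q y) <= e%:E)%E ->
  enorm (x - z) <= rho / 2 ->
  enorm (perp q (x - y)) <= e * rho /\
  forall u, enorm (perp q (u *m p)) <= 8 * e * enorm (u *m p).
Proof.
move=> hp hq rho0 h xz.
have px : plane_at p x x by rewrite /plane_at/= subrr /perp mul0mx subr0.
have h0 : enorm (perp q (x - y)) <= e * rho.
  by apply/set_dist_plane => //; apply: local_dist_le h _ _ => //; lra.
split=> // u; have := enorm_ge0 (u *m p); rewrite le_eqVlt => /orP[/eqP/esym|] u0.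
  by rewrite (enorm_eq0 u0) /perp mul0mx subr0 enorm0 mulr0.
set v := u *m p in u0 *; pose t := rho / (4 * enorm v).
have t0 : 0 < t by rewrite divr_gt0// mulr_gt0.
have tv : t * enorm v = rho / 4 by rewrite /t; field; rewrite gt_eqF.
have h1 : enorm (perp q (x + t *: v - y)) <= e * rho.
  apply/set_dist_plane => //; apply: local_dist_le h _ _ => //.
    by rewrite /v scalemxAl; exact: plane_at_mul.
  rewrite addrAC (le_lt_trans (ler_enormD _ _))// enormZ gtr0_norm// tv; lra.
have : enorm (t *: perp q v) <= 2 * e * rho.
  rewrite -perpZ (_ : t *: v = x + t *: v - y - (x - y)); last first.
    by apply/rowP => l; rewrite !mxE; ring.
  by rewrite perpB (le_trans (ler_enormB _ _))//; lra.
rewrite enormZ gtr0_norm// => h2; rewrite -(ler_pM2l t0).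
have -> : t * (8 * e * enorm v) = 2 * e * rho by rewrite mulrCA tv; field.
by [].
Qed.

Lemma local_dist_close p q x y z (rho e : R) : orthoproj p -> orthoproj q -> 0 < rho ->
  (local_dist z rho (plane_at p x) (plane_at q y) <= e%:E)%E -> 0 <= e ->
  enorm (x - z) <= rho / 2 -> enorm (y - z) <= rho / 2 ->
  [/\ forall u, enorm (u *m p - u *m q) <= 16 * e * enorm u,
      enorm (perp p (y - x)) <= e * rho & enorm (perp q (y - x)) <= e * rho].
Proof.
move=> hp hq rho0 h e0 xz yz.
have [h1 h2] := local_dist_perp hp hq rho0 h xz.
rewrite local_dist_sym in h.
have [h3 h4] := local_dist_perp hq hp rho0 h yz.
split=> //; last by rewrite -opprB perpN enormN.
move=> u; rewrite (_ : 16 * e = 2 * (8 * e)); last by ring.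
by apply: orthoproj_close => //; rewrite mulr_ge0.
Qed.

End Planes.

(** * The initial surface as a local Lipschitz graph *)

Section Surface.
Context {R : realType} {n : nat}.
Implicit Types (u v w x y z : 'rV[R]_n) (p q : 'M[R]_n) (P S : set 'rV[R]_n).

(** The mean value theorem holds for real functions, so it is applied to each coordinate along the
    segment; this costs the factor [n]. *)
Lemma derive_le_lip P (F : 'rV[R]_n -> 'rV[R]_n) (e l : R) y u :
  0 <= l -> (forall t, P (y + t *: u)) ->
  (forall z, P z -> derivable F z u) ->
  (forall z, P z -> enorm ('D_u F z) <= e) ->
  enorm (F (y + l *: u) - F y) <= n%:R * (e * l).
Proof.
move=> l0 Pseg dF DF; apply: enorm_le_coord => i.
pose phi (t : R) : R := F (y + t *: u) 0 i.
pose Fi (z : 'rV[R]_n) : R := F z 0 i.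
have dphi (t : R) : is_derive t 1 phi (('D_u F (y + t *: u)) 0 i).
  have dFt := dF _ (Pseg t).
  have dFi : derivable Fi (y + t *: u) u.
    by apply: (derivable_mxP F (y + t *: u) u).1.
  have E : (fun h : R => h^-1 *: (phi (h *: 1 + t) - phi t)) =
           (fun h : R => h^-1 *: (Fi (h *: u + (y + t *: u)) - Fi (y + t *: u))).
    apply/funext => h; rewrite /phi /Fi; congr (_ *: (F _ _ _ - _)).
    by rewrite -[h *: 1]/(h * 1) mulr1 scalerDl addrCA addrA.
  apply: DeriveDef; first by rewrite /derivable E.
  by rewrite derive_mx// mxE /derive E.
have cphi : {within `[0, l], continuous phi}.
  by apply: derivable_within_continuous => t _; exact: ex_derive.
have [c _] := MVT_segment l0 (fun t _ => dphi t) cphi.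
rewrite subr0 /phi scale0r addr0 !mxE => ->; rewrite normrM (ger0_norm l0).
by rewrite ler_wpM2r// (le_trans (ler_coord_enorm _ _) (DF _ (Pseg c))).
Qed.

Variables (d : nat) (eps : R) (S0 : set 'rV[R]_n).
Variables (Px : 'rV[R]_n -> set 'rV[R]_n) (Fx : 'rV[R]_n -> 'rV[R]_n -> 'rV[R]_n).

Lemma surface_fun x q : 0 <= eps -> smooth_surface d eps S0 Px Fx -> S0 x ->
    orthoproj q -> Px x = plane_at q x ->
  [/\ forall y, Px x y -> enorm (Fx x y) <= eps,
      forall y, Px x y -> Fx x y *m q = 0 &
      forall y y', Px x y -> Px x y' ->
        enorm (Fx x y' - Fx x y) <= n%:R * eps * enorm (y' - y)].
Proof.
move=> eps0 /(_ x) + S0x hq PxE => /(_ S0x)[_ orth C2 small _].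
have dirP u : direction (Px x) u <-> perp q u = 0.
  rewrite PxE; split=> [[y py [z pz <-]]|qu].
    rewrite (_ : y - z = y - x - (z - x)); last by rewrite opprB addrA subrK.
    by rewrite perpB py pz subr0.
  exists (x + u); first by rewrite /plane_at/= addrAC subrr add0r.
  exists x; first by rewrite /plane_at/= subrr /perp mul0mx subr0.
  by rewrite addrAC subrr add0r.
have dir0 : direction (Px x) 0 by apply/dirP; rewrite /perp mul0mx subr0.
have unit0 : unit_direction (Px x) (0 : 'rV[R]_n) by split=> //; rewrite enorm0.
(* The direction 0 belongs to the suprema, which are therefore nonnegative; single terms can then be
   extracted from the bound on the sum. *)
have D1_ge0 y : (0 <= D1_norm (Px x) (Fx x) y)%E.
  apply: le_trans (_ : (enorm ('D_0 (Fx x) y))%:E <= _)%E.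
    by rewrite lee_fin enorm_ge0.
  by apply: ereal_sup_ubound; exists 0.
have D2_ge0 y : (0 <= D2_norm (Px x) (Fx x) y)%E.
  apply: le_trans (_ : (enorm ('D_0 ('D_0 (Fx x)) y))%:E <= _)%E.
    by rewrite lee_fin enorm_ge0.
  by apply: ereal_sup_ubound; exists 0 => //; exists 0.
have F_small y : Px x y -> enorm (Fx x y) <= eps.
  move=> py; rewrite -lee_fin; apply: le_trans (small y py).
  by rewrite -addeA leeDl// adde_ge0.
have D_small y u : Px x y -> direction (Px x) u -> enorm u <= 1 ->
    enorm ('D_u (Fx x) y) <= eps.
  move=> py du u1; rewrite -lee_fin; apply: le_trans (small y py).
  apply: (@le_trans _ _ (D1_norm (Px x) (Fx x) y)).
    by apply: ereal_sup_ubound; exists u.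
  rewrite addeAC leeDr// adde_ge0//.
  by rewrite lee_fin enorm_ge0.
split=> // [y py|y y' py py'].
  (* The vector [Fx x y *m q] is parallel to the plane, hence orthogonal to [Fx x y]; as [q] is
     self-adjoint and idempotent, this scalar product is its squared norm. *)
  apply: enorm_eq0; apply/eqP; rewrite -sqrf_eq0 sqr_enorm.
  have := orth y py (Fx x y *m q); rewrite dirP perp_mul// => /(_ erefl).
  by rewrite [in X in _ -> X]dotp_mulmx hq.1 -mulmxA hq.2 dotpC => ->.
have := enorm_ge0 (y' - y); rewrite le_eqVlt => /orP[/eqP/esym|] yy'.
  by move/enorm_eq0: (yy') => /eqP; rewrite subr_eq0 => /eqP ->; rewrite !subrr enorm0 mulr0.
set l := enorm (y' - y) in yy' *.
pose u := l^-1 *: (y' - y).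
have du : direction (Px x) u.
  apply/dirP; rewrite perpZ (_ : y' - y = y' - x - (y - x)); last first.
    by rewrite opprB addrA subrK.
  by move: py py'; rewrite PxE /plane_at/= (perpB q (y' - x)) => -> ->; rewrite subr0 scaler0.
have u1 : enorm u <= 1.
  by rewrite enormZ normfV gtr0_norm// mulVf// gt_eqF.
have yu t : Px x (y + t *: u).
  move: py; rewrite PxE /plane_at/= addrAC (perpD q (y - x)) => ->.
  by rewrite add0r perpZ (dirP u).1// scaler0.
have -> : y' = y + l *: u.
  by rewrite scalerA mulfV ?gt_eqF// scale1r addrC subrK.
rewrite -mulrA; apply: (derive_le_lip (ltW yy') yu) => z pz.
  by have [/(_ z pz)] := C2.2 u u du du.
exact: D_small.
Qed.

(** The estimates are read at radius 60, well inside the radius 200 of the graph. The last clause is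
    the closedness of the graph of a continuous function; it will put the preimages of accumulation
    points on the surface. *)
Lemma surface_graph x : 0 <= eps -> n%:R * eps <= 1 -> eps <= 1 ->
    smooth_surface d eps S0 Px Fx -> S0 x ->
  exists q, [/\ orthoproj q, Px x = plane_at q x,
      forall z, affine_plane d (plane_at q z) &
    [/\ forall y, S0 y -> enorm (y - x) < 60 -> enorm (perp q (y - x)) <= eps,
        forall y y', S0 y -> S0 y' -> enorm (y - x) < 60 -> enorm (y' - x) < 60 ->
          enorm (perp q (y - y')) <= n%:R * eps * enorm (y - y'),
        forall u, enorm (u - x) < 50 ->
          exists y, [/\ S0 y, enorm (y - x) < 60 & (y - u) *m q = 0] &
        forall z, enorm (z - x) < 50 ->
          (forall e, 0 < e -> exists2 y, S0 y & enorm (y - z) < e) -> S0 z]].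
Proof.
move=> eps0 neps eps1 smooth S0x; have [[aff pxx] _ _ _ graph] := smooth x S0x.
have [q [hq PxE affq]] := affine_plane_proj aff pxx.
have [F_small F_orth F_lip] := surface_fun eps0 smooth S0x hq PxE.
have graphP y : S0 y -> enorm (y - x) < 60 ->
    exists2 z, Px x z & [/\ y = z + Fx x z, z - x = (y - x) *m q
      & perp q (y - x) = Fx x z].
  move=> S0y yx; have : (S0 `&` eball x 200) y by split=> //; rewrite /eball/=; lra.
  rewrite graph => -[[z pz zE] _]; exists z => //.
  have zq : (z - x) *m q = z - x.
    by move: pz; rewrite PxE => /eqP; rewrite subr_eq0 => /eqP <-.
  have E : (y - x) *m q = z - x by rewrite -zE addrAC mulmxDl F_orth// addr0.
  by split=> //; rewrite /perp E -zE; apply/rowP => l; rewrite !mxE; ring.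
exists q; split=> //; split.
- by move=> y S0y yx; have [z pz [_ _ ->]] := graphP y S0y yx; exact: F_small.
- move=> y y' S0y S0y' yx y'x.
  have [z pz [_ zq zF]] := graphP y S0y yx; have [z' pz' [_ z'q z'F]] := graphP y' S0y' y'x.
  have -> : y - y' = y - x - (y' - x) by rewrite opprB addrA subrK.
  rewrite perpB zF z'F (le_trans (F_lip _ _ pz' pz))// ler_wpM2l ?mulr_ge0//.
  have -> : z - z' = (y - x - (y' - x)) *m q.
    by rewrite mulmxBl -zq -z'q opprB addrA subrK.
  exact: enorm_proj.
- move=> u ux; pose z := x + (u - x) *m q.
  have pz : Px x z by rewrite PxE; exact: plane_at_mul.
  have zx : enorm (z - x) < 50.
    by rewrite /z addrAC subrr add0r (le_lt_trans (enorm_proj _ hq)).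
  have yx : enorm (z + Fx x z - x) < 60.
    by rewrite addrAC (le_lt_trans (ler_enormD _ _))//; have := F_small z pz; lra.
  have : (graph_over (Px x) (Fx x) `&` eball x 200) (z + Fx x z).
    by split; [exists z | rewrite /eball/=; lra].
  rewrite -graph => -[S0y _]; exists (z + Fx x z); split=> //.
  have -> : z + Fx x z - u = (u - x) *m q + Fx x z - (u - x).
    by rewrite /z; apply/rowP => l; rewrite !mxE; ring.
  by rewrite mulmxBl mulmxDl F_orth// addr0 -mulmxA hq.2 subrr.
- move=> z zx approx; pose z0 := x + (z - x) *m q.
  have pz0 : Px x z0 by rewrite PxE; exact: plane_at_mul.
  suff zE : z = z0 + Fx x z0.
    have : (graph_over (Px x) (Fx x) `&` eball x 200) z.
      by split; [exists z0 => //; rewrite -zE | rewrite /eball/=; lra].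
    by rewrite -graph => -[].
  apply/eqP; rewrite -subr_eq0; apply/eqP/enorm_eq0/eqP; rewrite eq_le enorm_ge0 andbT.
  apply/ler_addgt0Pr => e e0; rewrite add0r.
  (* The 1 keeps the approximating point in the range of the graph; [e / 3] serves the three terms
     of the final decomposition. *)
  pose e' := Num.min 1 (e / 3).
  have e'0 : 0 < e' by rewrite lt_min ltr01 divr_gt0.
  have e'1 : e' <= 1 by rewrite ge_min lexx.
  have e'e : 3 * e' <= e by rewrite -ler_pdivlMl// mulrC ge_min lexx orbT.
  have [y S0y yz] := approx e' e'0.
  have yx : enorm (y - x) < 60 by have := enorm_triangle z y x; lra.
  have [w pw [yE wq wF]] := graphP y S0y yx.
  have wz : enorm (w - z0) <= enorm (y - z).
    have -> : w - z0 = (y - z) *m q.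
      have -> : w - z0 = w - x - (z - x) *m q by rewrite /z0 opprD addrA.
      by rewrite wq -mulmxBl opprB addrA subrK.
    exact: enorm_proj.
  have Fwz : enorm (Fx x w - Fx x z0) <= enorm (y - z).
    apply: le_trans (F_lip _ _ pz0 pw) _.
    have := enorm_ge0 (w - z0); nra.
  have -> : z - (z0 + Fx x z0) = (w - z0) + (Fx x w - Fx x z0) - (y - z).
    by rewrite yE; apply/rowP => l; rewrite !mxE; ring.
  have := ler_enormB (w - z0 + (Fx x w - Fx x z0)) (y - z).
  have := ler_enormD (w - z0) (Fx x w - Fx x z0).
  by lra.
Qed.

End Surface.

(** * Coherence of the planes and flatness at generation 0 *)

Section Base.
Context {R : realType} {n : nat}.
Variables (d : nat) (eps : R) (X : ccbp_data R n).
Variables (Px : 'rV[R]_n -> set 'rV[R]_n) (Fx : 'rV[R]_n -> 'rV[R]_n -> 'rV[R]_n).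
Implicit Types (u v w x y z : 'rV[R]_n).

(** The second clause is meant for planes through points of the limit set, which are parallel to the
    given planes but need not contain their centers. *)
Definition plane_proj (p : forall k, index X k -> 'M[R]_n) : Prop :=
  forall k (j : index X k), plane j = plane_at (p k j) (center j) /\
    forall z, affine_plane d (plane_at (p k j) z).

(** The factor 100 covers the tilt [16 * eps] and the offsets, [100 * eps] within a generation and
    [20 * eps] between successive ones, according to the radii of the balls of comparison. *)
Lemma ccbp_coherent : 0 < eps -> coherent_balls eps X ->
    coherent_planes d eps X Px ->
  exists p, coherent (@Defs.center R n X) p (100 * eps) /\ plane_proj p.
Proof.
move=> eps0 [sep near _] [aff same _ next].
have proj k (j : index X k) : exists p : 'M[R]_n, [/\ orthoproj p,
    plane j = plane_at p (center j) & forall z, affine_plane d (plane_at p z)].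
  by have [affj jc] := aff k j; exact: affine_plane_proj affj jc.
have [p pP] : exists p : forall k, index X k -> 'M[R]_n, forall k j,
    [/\ orthoproj (p k j), plane j = plane_at (p k j) (center j) &
        forall z, affine_plane d (plane_at (p k j) z)].
  by exists (fun k j => projT1 (cid (proj k j))) => k j; exact: projT2 (cid (proj k j)).
exists p; split; last by move=> k j; have [_ ? ?] := pP k j.
have r0 k : 0 < radius k :> R := radius_gt0 k.
split.
- by move=> k j; have [] := pP k j.
- exact: sep.
- by move=> k j; have [i _ ij] := near k j; exists i.
- move=> k i j ij; have ri := r0 k.
  have [hi iE _] := pP k i; have [hj jE _] := pP k j.
  have := same k i j; rewrite iE jE => /(_ _) hd.
  have ij100 : enorm (center i - center j) <= 100 * radius k.
    by apply: le_trans ij _; lra.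
  have rho0 : 0 < 100 * radius k :> R by rewrite mulr_gt0.
  have [||h1 h2 h3] := local_dist_close hi hj rho0 (hd ij100) (ltW eps0).
  + by apply: le_trans ij _; lra.
  + by rewrite subrr enorm0; lra.
  split; [|lra|lra].
  move=> u; apply: le_trans (h1 u) _; rewrite ler_wpM2r ?enorm_ge0//; lra.
- move=> k i j ij; have ri := r0 k.
  have [hi iE _] := pP k i; have [hj jE _] := pP k.+1 j.
  have := next k i j ij; rewrite iE jE => hd.
  have rho0 : 0 < 20 * radius k :> R by rewrite mulr_gt0.
  have [||h1 h2 h3] := local_dist_close hi hj rho0 hd (ltW eps0).
  + by rewrite subrr enorm0; lra.
  + by rewrite enormB; apply: le_trans ij _; lra.
  have er : 0 < eps * radius k by rewrite mulr_gt0.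
  split; [|lra|lra].
  move=> u; apply: le_trans (h1 u) _; rewrite ler_wpM2r ?enorm_ge0//; lra.
Qed.

(** A center of generation 0 is within [2 * eps] of a surface point [x], the factor 2 being there
    because the distance may not be attained. The surface is a graph over the plane at [x], tilted
    by at most [16 * eps] from the plane of the center. *)
Lemma flat_base_surface p a : 0 < eps -> eps <= 60^-1 ->
    smooth_surface d eps (surface X) Px Fx -> coherent_balls eps X ->
    coherent_planes d eps X Px ->
    coherent (@Defs.center R n X) p (100 * eps) -> plane_proj p ->
    (n%:R + 50) * eps <= a / 10 -> 60 * (n%:R + 1) * (4 * n%:R + 1) * a <= 1 ->
  flat_at (@Defs.center R n X) p a (surface X) 0 (surface X).
Proof.
move=> eps0 eps1 smooth [_ _ near0] [_ _ base _] coh pP a_ge a_le.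
have n0 : 0 <= n%:R :> R by [].
have neps0 : 0 <= n%:R * eps by rewrite mulr_ge0// ltW.
have a0 : 0 <= a by lra.
have a60 : 60 * a <= 1.
  by apply: le_trans a_le; rewrite ler_wpM2r//; nra.
have graph (j : index X 0) : exists q x, [/\ orthoproj q,
    surface X x, enorm (x - center j) <= 2 * eps,
    (forall u, enorm (u *m q - u *m p 0 j) <= 16 * eps * enorm u) &
    [/\ forall y, surface X y -> enorm (y - x) < 60 -> enorm (perp q (y - x)) <= eps,
        forall y y', surface X y -> surface X y' ->
          enorm (y - x) < 60 -> enorm (y' - x) < 60 ->
          enorm (perp q (y - y')) <= n%:R * eps * enorm (y - y') &
        forall u, enorm (u - x) < 50 ->
          exists y, [/\ surface X y, enorm (y - x) < 60 & (y - u) *m q = 0]]].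
  have : (set_dist (center j) (surface X) < (2 * eps)%:E)%E.
    by apply: le_lt_trans (near0 j) _; rewrite lte_fin; lra.
  move/ereal_inf_lt => [_ [x Sx <-]]; rewrite lte_fin => /ltW jx.
  have [|||q [hq qE affq [g1 g2 g3 _]]] := surface_graph _ _ _ smooth Sx; try lra.
  exists q, x; split=> //; first by rewrite enormB.
  have jx2 : enorm (center j - x) <= 2 by lra.
  have hj := coh_proj coh j.
  have := base j x Sx jx2; rewrite qE (pP 0%N j).1.
  have rho0 : 0 < 100 :> R by [].
  move=> hd; have [||h1 _ _] := local_dist_close hj hq rho0 hd (ltW eps0).
  - by rewrite subrr enorm0; lra.
  - by rewrite enormB; lra.
  by move=> u; rewrite enormB.
have const : 6 * (n%:R + 1) * (4 * n%:R + 1) * a <= 1.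
  by apply: le_trans a_le; rewrite ler_wpM2r//; nra.
have a_ge16 : 16 * eps <= a by lra.
have a_gen : (n%:R + 16) * eps <= a by lra.
have a_ge50 : 50 * eps <= a / 10 by lra.
clear a_le n0.
split.
- move=> j y Sy; rewrite radius_0 !mulr1 => yj.
  have [q [x [hq Sx xj hpq [g1 _ _]]]] := graph j.
  apply: le_trans (perp_le_close (hpq _)) _.
  have yx : enorm (y - x) < 60.
    by have := enorm_triangle (center j) y x; rewrite (enormB (center j) x); lra.
  have -> : y - center j = y - x + (x - center j) by rewrite addrA subrK.
  rewrite perpD; have := ler_enormD (perp q (y - x)) (perp q (x - center j)).
  have := g1 y Sy yx; have := enorm_perp (x - center j) hq.
  have := ler_enormD (y - x) (x - center j).
  have -> : y - x + (x - center j) = y - center j by rewrite addrA subrK.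
  by have := ler_wpM2l (ltW eps0) (ltW yj); lra.
- move=> j y y' Sy Sy'; rewrite radius_0 !mulr1 => yj y'j.
  have [q [x [hq Sx xj hpq [_ g2 _]]]] := graph j.
  apply: le_trans (perp_le_close (hpq _)) _.
  have yx : enorm (y - x) < 60.
    by have := enorm_triangle (center j) y x; rewrite (enormB (center j) x); lra.
  have y'x : enorm (y' - x) < 60.
    by have := enorm_triangle (center j) y' x; rewrite (enormB (center j) x); lra.
  have := g2 y y' Sy Sy' yx y'x; have := ler_wpM2r (enorm_ge0 (y - y')) a_gen; lra.
- clear a_ge; move=> j v; rewrite radius_0 !mulr1 => vj.
  have [q [x [hq Sx xj hpq [g1 g2 g3]]]] := graph j; have hj := coh_proj coh j.
  pose v' := x + (v - x) *m p 0 j.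
  pose A := [set y | surface X y /\ enorm (y - x) < 60].
  have vx : enorm (v - x) < 21.
    by have := enorm_triangle (center j) v x; rewrite (enormB (center j) x); lra.
  have v'x : v' - x = (v - x) *m p 0 j by rewrite /v' addrAC subrr add0r.
  have v'x' : enorm (v' - x) <= enorm (v - x) by rewrite v'x enorm_proj.
  (* With the identity as [tau], the lift only changes the projection, from that of the graph to
     that of the center. *)
  have [|||||||||y [[Sy yx] yv yv']] := @projection_lift _ _ A q (p 0 j) id x a 1 50
     hq hj a0 ltr01 _ _ _ _ _ _ _ v'.
  + exact: const.
  + by move=> u; apply: le_trans (hpq u) _; rewrite ler_wpM2r ?enorm_ge0.
  + move=> y y' [Sy yx] [Sy' y'x]; apply: le_trans (g2 _ _ Sy Sy' yx y'x) _.
    by rewrite ler_wpM2r ?enorm_ge0//; lra.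
  + by move=> y y' _ _; rewrite subrr enorm0 mulr_ge0 ?enorm_ge0.
  + by move=> y _; rewrite subrr enorm0 mulr1.
  + by move=> y [Sy yx]; have := g1 y Sy yx; lra.
  + by move=> u /g3[y [Sy yx yu]]; exists y.
  + lra.
  + rewrite v'x; have := perp_le_close (q := p 0%N j) (q' := q)
      (delta := 16 * eps) (u := (v - x) *m p 0%N j).
    rewrite perp_mul// enorm0 add0r => /(_ _)/le_trans; apply.
      by rewrite enormB; exact: hpq.
    by rewrite -v'x; nra.
  exists y; split=> //.
  + have := enorm_triangle v' y (center j); have := enorm_triangle x v' (center j).
    by have := enorm_triangle (center j) v x; rewrite (enormB (center j) x); lra.
  + have -> : y - v = y - v' + (v' - v) by rewrite addrA subrK.
    rewrite mulmxDl yv add0r /v'.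
    have -> : x + (v - x) *m p 0 j - v = (v - x) *m p 0 j - (v - x).
      by apply/rowP => l; rewrite !mxE; ring.
    by rewrite mulmxBl -mulmxA hj.2 subrr.
- by move=> s Ss; exists s => //; rewrite subrr enorm0 radius_0 subrr mul0r.
Qed.

End Base.

(** * Geometric convergence *)

Section GeometricLimits.
Context {R : realType} {n : nat}.
Implicit Types (z w : 'rV[R]_n).

Lemma le_geometric_le0 (a c : R) : (forall k, a <= c * 2 ^- k) -> a <= 0.
Proof.
move=> h; rewrite leNgt; apply/negP => a0.
have c0 : 0 < c by have := h 0; rewrite expr0 invr1 mulr1; lra.
have [k hk] : exists k : nat, c / a < k%:R.
  by exists (Num.truncn (c / a)).+1; rewrite truncnS_gt.
have : k%:R <= 2 ^+ k :> R by rewrite -natrX ler_nat ltnW// ltn_expl.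
have := h k; rewrite ler_pdivlMr ?exprn_gt0// => h1 h2.
move: hk; rewrite ltr_pdivrMr// ltNge => /negP; apply.
apply: le_trans h1; rewrite mulrC ler_wpM2l//; exact: ltW.
Qed.

(** In each coordinate the intervals of center [u k] and radius [rho k] meet pairwise, so the
    infimum of their upper ends lies in all of them; the limit comes with its rate. *)
Lemma geometric_limit (u : nat -> 'rV[R]_n) (c q : R) :
  0 <= c -> 0 <= q -> q <= 2^-1 ->
  (forall k, enorm (u k.+1 - u k) <= c * q ^+ k) ->
  exists w, forall k, enorm (w - u k) <= n%:R * (2 * c * q ^+ k).
Proof.
move=> c0 q0 q1 du; pose rho k := 2 * c * q ^+ k.
have rho0 k : 0 <= rho k by rewrite !mulr_ge0// exprn_ge0.
(* As [q <= 1/2], the increment [c * q ^ k] is at most [rho k - rho (k + 1)], and the bounds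
   telescope. *)
have tele k m : enorm (u (k + m)%N - u k) <= rho k - rho (k + m)%N.
  elim: m => [|m ih]; first by rewrite addn0 !subrr enorm0.
  rewrite addnS; have := enorm_triangle (u (k + m)%N) (u (k + m).+1) (u k).
  have := du (k + m)%N; move: ih; rewrite /rho exprS.
  have : 0 <= c * q ^+ (k + m) by rewrite mulr_ge0// exprn_ge0.
  by move: (q ^+ (k + m)) => t; nra.
have dist k l : enorm (u k - u l) <= rho k + rho l.
  case/orP: (leq_total k l) => /subnKC <-.
    by rewrite enormB; have := tele k (l - k)%N; have := rho0 (k + (l - k))%N; lra.
  by have := tele l (k - l)%N; have := rho0 (l + (k - l))%N; lra.
pose A i := range (fun l => u l 0 i + rho l).
have lbA i k : lbound (A i) (u k 0 i - rho k).
  move=> _ [l _ <-]; have := le_trans (ler_coord_enorm _ i) (dist k l).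
  by rewrite !mxE ler_norml => /andP[_]; lra.
have A0 i : A i !=set0 by exists (u 0 0 i + rho 0), 0.
exists (\row_i inf (A i)) => k; apply: enorm_le_coord => i; rewrite !mxE.
have h1 : inf (A i) <= u k 0 i + rho k.
  by apply: ge_inf; [exists (u 0 0 i - rho 0); exact: lbA | exists k].
have h2 : u k 0 i - rho k <= inf (A i) by apply: lb_le_inf => //; exact: lbA.
by rewrite ler_norml -/(rho k); apply/andP; split; lra.
Qed.

End GeometricLimits.

(** * The limit of the iterates and its surjectivity *)

Section LimitMap.
Context {R : realType} {n : nat}.
Variables (h : nat -> 'rV[R]_n -> 'rV[R]_n).
Implicit Types (z w : 'rV[R]_n).

Fixpoint iterates k z : 'rV[R]_n :=
  if k is k'.+1 then iterates k' z + h k' (iterates k' z) else z.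

Definition small_displacements (eta : R) : Prop := forall k,
  (forall z z', enorm (h k z - h k z') <= eta * enorm (z - z')) /\
  forall z, enorm (h k z) <= eta * radius k.

Variable eta : R.

Lemma iterates_step_ge k z z' : small_displacements eta ->
  (1 - eta) * enorm (iterates k z - iterates k z') <=
  enorm (iterates k.+1 z - iterates k.+1 z').
Proof. by move=> hh; apply: perturb_id_ge; exact: (hh k).1. Qed.

Lemma iterates_step_le k z z' : small_displacements eta ->
  enorm (iterates k.+1 z - iterates k.+1 z') <=
  (1 + eta) * enorm (iterates k z - iterates k z').
Proof. by move=> hh; apply: perturb_id_le; exact: (hh k).1. Qed.

Lemma iterates_ge k z z' : small_displacements eta -> eta <= 1 ->
  (1 - eta) ^+ k * enorm (z - z') <= enorm (iterates k z - iterates k z').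
Proof.
move=> hh eta1; elim: k => [|k ih]; first by rewrite expr0 mul1r.
apply: le_trans (iterates_step_ge k z z' hh).
by rewrite exprS -mulrA ler_wpM2l// subr_ge0.
Qed.

Lemma iterates_le k z z' : small_displacements eta -> 0 <= eta ->
  enorm (iterates k z - iterates k z') <= (1 + eta) ^+ k * enorm (z - z').
Proof.
move=> hh eta0; elim: k => [|k ih]; first by rewrite expr0 mul1r.
apply: le_trans (iterates_step_le k z z' hh) _.
by rewrite exprS -mulrA ler_wpM2l// addr_ge0.
Qed.

Lemma iterates_surj k w : small_displacements eta -> 0 <= eta -> n%:R * eta < 1 ->
  exists z, iterates k z = w.
Proof.
move=> hh eta0 neta; elim: k w => [|k ih] w; first by exists w.
have [y <-] := perturb_id_surj eta0 neta (hh k).1 w.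
by have [z <-] := ih y; exists z.
Qed.

Lemma limit_map : small_displacements eta -> 0 <= eta ->
  exists g : 'rV[R]_n -> 'rV[R]_n, forall z k,
    enorm (g z - iterates k z) <= 2 * n%:R * eta * radius k.
Proof.
move=> hh eta0.
have /choice[g gP] z : exists w, forall k,
    enorm (w - iterates k z) <= 2 * n%:R * eta * radius k; last by exists g.
have q0 : 0 <= 10^-1 :> R by lra.
have q1 : 10^-1 <= 2^-1 :> R by lra.
have [k|w hw] := geometric_limit (u := fun k => iterates k z) eta0 q0 q1.
  by rewrite /= addrAC subrr add0r exprVn; exact: (hh k).2.
by exists w => k; have := hw k; rewrite exprVn -/(radius k); lra.
Qed.

Variables (theta : R) (g : 'rV[R]_n -> 'rV[R]_n).
Hypothesis gP : forall z k, enorm (g z - iterates k z) <= theta * radius k.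

(** The preimages [u k] of [w] under the iterates converge: their images by the [k]-th iterate are
    [eta * 10 ^ - k] apart, and this iterate contracts by at most [(1 - eta) ^ k], so they are
    [eta * 9 ^ - k] apart. The expansion [(1 + eta) ^ k] of the iterates is in turn beaten by this
    rate. *)
Lemma limit_map_surj w : small_displacements eta -> 0 <= eta -> n%:R * eta < 1 ->
  50 * eta <= 1 -> exists z, g z = w.
Proof.
move=> hh eta0 neta eta1.
have /choice[u uP] k : exists z, iterates k z = w by exact: iterates_surj.
have q0 : 0 <= 9^-1 :> R by lra.
have q1 : 9^-1 <= 2^-1 :> R by lra.
have [k|z zP] := geometric_limit (u := u) eta0 q0 q1.
  have e1 : enorm (iterates k (u k.+1) - iterates k (u k)) <= eta * 10 ^- k.
    rewrite uP -(uP k.+1) /= opprD addNKr enormN; exact: (hh k).2.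
  have e2 := iterates_ge k (u k.+1) (u k) hh (_ : eta <= 1).
  have b0 : 0 < (1 - eta) ^+ k by rewrite exprn_gt0//; lra.
  rewrite -(ler_pM2l b0); apply: le_trans (e2 _) _; first by lra.
  apply: le_trans e1 _; rewrite mulrCA ler_wpM2l// -exprVn -exprMn.
  by rewrite lerXn2r ?nnegrE; lra.
exists z; apply/eqP; rewrite -subr_eq0; apply/eqP/enorm_eq0/eqP.
rewrite eq_le enorm_ge0 andbT.
have theta0 : 0 <= theta.
  by have := le_trans (enorm_ge0 _) (gP 0 0); rewrite radius_0 mulr1.
apply: (@le_geometric_le0 _ _ (theta + n%:R * (2 * eta))) => k.
apply: le_trans (enorm_triangle (iterates k z) _ _) _; rewrite mulrDl lerD//.
  apply: le_trans (gP z k) _; rewrite ler_wpM2l// lef_pV2 ?posrE ?exprn_gt0//.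
  by rewrite lerXn2r ?nnegrE; lra.
rewrite -{1}(uP k); apply: le_trans (iterates_le k _ _ hh eta0) _.
have b0 : 0 <= (1 + eta) ^+ k by rewrite exprn_ge0//; lra.
apply: le_trans (ler_wpM2l b0 (zP k)) _.
have : ((1 + eta) * 9^-1) ^+ k <= 2 ^- k by rewrite -exprVn lerXn2r ?nnegrE; lra.
rewrite exprMn; move: ((1 + eta) ^+ k) (9^-1 ^+ k) => A B AB.
have -> : A * (n%:R * (2 * eta * B)) = n%:R * (2 * eta) * (A * B) by ring.
by rewrite ler_wpM2l// !mulr_ge0.
Qed.

End LimitMap.

(** * Hoelder bounds for the limit *)

Section LimitMapHolder.
Context {R : realType} {n : nat}.
Variables (h : nat -> 'rV[R]_n -> 'rV[R]_n) (eta theta : R).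
Variable g : 'rV[R]_n -> 'rV[R]_n.
Implicit Types (z w : 'rV[R]_n).

(* After the first such [k], the total displacement is small with respect to the
   distance between the images of [z] and [z']. *)
Lemma separation_time z z' : small_displacements h eta -> 0 <= eta -> 50 * eta <= 1 ->
  0 < enorm (z' - z) <= 1 ->
  exists k, radius k <= enorm (iterates h k z' - iterates h k z) /\
    enorm (iterates h k.-1 z' - iterates h k.-1 z) <= radius k.-1.
Proof.
move=> hh eta0 eta1 /andP[s0 s1].
have ex : exists k, radius k <= enorm (iterates h k z' - iterates h k z).
  apply: contrapT => /forallNP far.
  have : enorm (z' - z) <= 0; last by rewrite leNgt s0.
  apply: (@le_geometric_le0 _ _ 1) => k; rewrite mul1r.
  have b0 : 0 < (1 - eta) ^+ k by rewrite exprn_gt0//; lra.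
  have e1 : (1 - eta) ^+ k * enorm (z' - z) <= 10 ^- k.
    have /negP := far k; rewrite -ltNge => /ltW; apply: le_trans.
    by apply: iterates_ge => //; lra.
  rewrite -(ler_pM2l b0); apply: le_trans e1 _.
  rewrite -!exprVn -exprMn lerXn2r ?nnegrE//; lra.
exists (ex_minn ex); case: ex_minnP => k kP kmin; split=> //.
case: k kP kmin => [|k] kP kmin; first by rewrite radius_0.
by rewrite /= leNgt; apply/negP => /ltW /kmin; rewrite ltnn.
Qed.

(** A crude bound is enough, since it is used only to get [e <= 10 * (1 - eta)]. *)
Lemma expR1_le4 : expR 1 <= 4 :> R.
Proof.
have h1 : 2^-1 <= expR (- 2^-1) :> R by have := expR_ge1Dx (- 2^-1 : R); lra.
have h2 : expR 2^-1 * expR (- 2^-1) = 1 :> R by exact: expRxMexpNx_1.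
have -> : 1 = 2^-1 + 2^-1 :> R by lra.
by rewrite expRD; have := expR_gt0 (2^-1 : R); nra.
Qed.

(** At the separation time, [g] sees the distance of the iterates up to a factor near 1. Just
    before, the iterates are at most [10 ^ - m] apart while their distance is at least
    [(1 - eta) ^ m * s], which gives [m <= - ln s]. Hence [(1 + eta) ^ m <= exp (beta * m) <= s ^ (-
    beta)], and similarly from below. *)
Lemma limit_map_holder (beta : R) z z' :
  small_displacements h eta -> 0 <= eta -> eta <= theta -> 50 * theta <= 1 ->
  (forall z k, enorm (g z - iterates h k z) <= theta * radius k) ->
  2 * theta <= beta -> beta < 1 -> enorm (z' - z) <= 1 ->
  4^-1 * enorm (z' - z) `^ (1 + beta) <= enorm (g z' - g z)
    <= 3 * enorm (z' - z) `^ (1 - beta).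
Proof.
move=> hh eta0 eta_theta theta1 gP theta_beta beta1 s1.
have := enorm_ge0 (z' - z); rewrite le_eqVlt => /orP[/eqP/esym s0|s0].
  have /eqP := enorm_eq0 s0; rewrite subr_eq0 => /eqP ->.
  by rewrite !subrr enorm0 !powR0 ?gt_eqF// ?mulr0 ?lexx//; lra.
have eta1 : 50 * eta <= 1 by lra.
have s01 : 0 < enorm (z' - z) <= 1 by rewrite s0.
have [k [kP]] := separation_time hh eta0 eta1 s01.
set m := k.-1 => mP.
have km : (k <= m.+1)%N by rewrite /m; case: (k).
set s := enorm (z' - z) in s0 s1 *.
set sk := enorm (iterates h k z' - iterates h k z) in kP.
have sk_ge : (1 - eta) * ((1 - eta) ^+ m * s) <= sk.
  have e1 : (1 - eta) ^+ k * s <= sk by apply: iterates_ge => //; lra.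
  apply: le_trans e1; rewrite mulrA -exprS ler_wpM2r ?(ltW s0)//.
  by rewrite ler_wiXn2l//; lra.
have sk_le : sk <= (1 + eta) * ((1 + eta) ^+ m * s).
  have e1 : sk <= (1 + eta) ^+ k * s by exact: iterates_le.
  apply: le_trans e1 _; rewrite mulrA -exprS ler_wpM2r ?(ltW s0)//.
  by rewrite ler_weXn2l//; lra.
have [ge_g le_g] : (1 - 2 * theta) * sk <= enorm (g z' - g z) /\
    enorm (g z' - g z) <= (1 + 2 * theta) * sk.
  have h1 := gP z k; have h2 := gP z' k.
  have := enorm_triangle (iterates h k z') (g z') (g z).
  have := enorm_triangle (iterates h k z) (iterates h k z') (g z).
  have := enorm_triangle (g z') (iterates h k z') (iterates h k z).
  have := enorm_triangle (g z) (g z') (iterates h k z).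
  rewrite (enormB (iterates h k z) (g z)) (enormB (iterates h k z') (g z')) -/sk.
  by have : theta * radius k <= theta * sk; [rewrite ler_wpM2l//; lra | split; lra].
have lns : ln s <= - m%:R.
  have e1 : (1 - eta) ^+ m * s <= radius m.
    by apply: le_trans mP; apply: iterates_ge => //; lra.
  have e4 : expR 1 ^+ m * s <= 1.
    have e2 : expR 1 ^+ m <= (10 * (1 - eta)) ^+ m.
      by rewrite lerXn2r ?nnegrE ?expR_ge0//; have := expR1_le4; lra.
    apply: le_trans (ler_wpM2r (ltW s0) e2) _; rewrite exprMn -mulrA.
    have p10 : 0 < 10 ^+ m :> R by rewrite exprn_gt0.
    by have := ler_wpM2l (ltW p10) e1; rewrite /Defs.radius mulfV ?gt_eqF.
  rewrite -ler_expR lnK ?posrE// expRN -[m%:R]mul1r expRM_natr.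
  by rewrite -[leRHS]mulr1 ler_pdivlMl// ?exprn_gt0 ?expR_gt0.
have powE b : s `^ (1 + b) = s * expR (b * ln s).
  have c : (1 + b == 0) ==> (s != 0) by rewrite (gt_eqF s0) implybT.
  by rewrite (powRD c) powRr1 ?(ltW s0)// /powR (gt_eqF s0).
have beta0 : 0 <= beta by lra.
apply/andP; split.
- rewrite powE.
  have e1 : expR (beta * ln s) <= (1 - eta) ^+ m.
    apply: (@le_trans _ _ (expR (- beta) ^+ m)).
      by rewrite -expRM_natr ler_expR mulNr -mulrN ler_wpM2l.
    rewrite lerXn2r ?nnegrE ?expR_ge0//; first by lra.
    rewrite expRN -[_^-1]mul1r ler_pdivrMr ?expR_gt0//.
    by have := expR_ge1Dx beta; nra.
  apply: le_trans ge_g.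
  have eta_le1 : 0 <= 1 - eta by lra.
  have : 0 <= (1 - eta) ^+ m * s := mulr_ge0 (exprn_ge0 m eta_le1) (ltW s0).
  have := ler_wpM2r (ltW s0) e1; move: sk_ge; rewrite (mulrC s).
  move: ((1 - eta) ^+ m * s) (expR _ * s) => A B skA BA A0.
  have h1 : eta * A <= 50^-1 * A by rewrite ler_wpM2r//; lra.
  have sk0 : 0 <= sk := enorm_ge0 _.
  have h2 : 2 * theta * sk <= 2^-1 * sk by rewrite ler_wpM2r//; lra.
  by lra.
- rewrite powE mulNr.
  have e1 : (1 + eta) ^+ m <= expR (- (beta * ln s)).
    apply: (@le_trans _ _ (expR beta ^+ m)).
      rewrite lerXn2r ?nnegrE ?expR_ge0//; first by lra.
      by have := expR_ge1Dx beta; lra.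
    by rewrite -expRM_natr ler_expR -mulrN ler_wpM2l// lerNr.
  apply: le_trans le_g _.
  have eta_ge1 : 0 <= 1 + eta by lra.
  have : 0 <= (1 + eta) ^+ m * s := mulr_ge0 (exprn_ge0 m eta_ge1) (ltW s0).
  have := ler_wpM2r (ltW s0) e1; move: sk_le; rewrite (mulrC s).
  move: ((1 + eta) ^+ m * s) (expR _ * s) => A B skA AB A0.
  have h1 : eta * A <= 50^-1 * A by rewrite ler_wpM2r//; lra.
  have sk0 : 0 <= sk := enorm_ge0 _.
  have h2 : 2 * theta * sk <= 2^-1 * sk by rewrite ler_wpM2r//; lra.
  by lra.
Qed.

End LimitMapHolder.

(** * Reifenberg flatness of the limit surface *)

Section LocalDist.
Context {R : realType} {n : nat}.

Lemma enorm_addK (x u : 'rV[R]_n) : enorm (x + u - x) = enorm u.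
Proof. by rewrite addrAC subrr add0r. Qed.

Implicit Types (u v w x y z : 'rV[R]_n) (q : 'M[R]_n) (E : set 'rV[R]_n).

Lemma set_dist_le y F z (c : R) : F z -> enorm (y - z) <= c ->
  (set_dist y F <= c%:E)%E.
Proof.
move=> Fz yz; apply: le_trans (_ : (enorm (y - z))%:E <= _)%E; last by rewrite lee_fin.
by apply: ereal_inf_lbound; exists z.
Qed.

Lemma local_dist_plane_le q E x (t c : R) : orthoproj q -> 0 < t ->
  (forall w, E w -> enorm (w - x) < t -> enorm (perp q (w - x)) <= c * t) ->
  (forall v, enorm (v - x) < t -> perp q (v - x) = 0 ->
     exists2 w, E w & enorm (w - v) <= c * t) ->
  (local_dist x t E (plane_at q x) <= c%:E)%E.
Proof.
move=> hq t0 hE hP; rewrite /local_dist lee_pdivrMl// -EFinM mulrC ge_max.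
apply/andP; split; apply: ge_ereal_sup => _ [v [Ev vx] <-].
  apply: (@set_dist_le _ _ (x + (v - x) *m q)); first exact: plane_at_mul.
  by rewrite opprD addrA; exact: hE.
have [w Ew wv] := hP v vx Ev.
by apply: set_dist_le Ew _; rewrite enormB.
Qed.

End LocalDist.

Section Construction.
Context {R : realType} {n : nat}.
Variables (d : nat) (delta a eta theta : R) (X : ccbp_data R n).
Variables (p : forall k, index X k -> 'M[R]_n).
Variables (h : nat -> 'rV[R]_n -> 'rV[R]_n) (g : 'rV[R]_n -> 'rV[R]_n).
Implicit Types (u v w x y z : 'rV[R]_n) (q : 'M[R]_n).

Definition generation k : set 'rV[R]_n := iterates h k @` surface X.

Definition graph_at q (c : R) x : Prop :=
  [/\ orthoproj q, forall z, affine_plane d (plane_at q z),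
    forall y y', surface X y -> surface X y' ->
      enorm (y - x) < 4 -> enorm (y' - x) < 4 ->
      enorm (perp q (y - y')) <= c * enorm (y - y') &
    forall v, enorm (v - x) < 2 -> perp q (v - x) = 0 ->
      exists y, [/\ surface X y, enorm (y - x) < 4 & (y - v) *m q = 0]].

(** The last bound of [con_small] has [2 * eta], the constant with which [projection_lift] is
    applied once more in [generation_graph]. *)
Record construction : Prop := Construction {
  con_coh : coherent (@Defs.center R n X) p delta;
  con_plane : plane_proj d p;
  con_disp : small_displacements h eta;
  con_far : forall k y, generation k y ->
    (forall j : index X k, 10 * radius k <= enorm (y - center j)) -> h k y = 0;
  con_fix : forall k z, (forall s, surface X s -> 2 <= enorm (z - s)) -> h k z = 0;
  con_flat : forall k, flat_at (@Defs.center R n X) p a (surface X) k (generation k);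
  con_graph : forall x, surface X x -> exists q, graph_at q a x;
  con_lim : forall z k, enorm (g z - iterates h k z) <= theta * radius k;
  con_small : [/\ 0 <= a, a <= eta, eta <= theta, 50 * theta <= 4^-1 &
    6 * (n%:R + 1) * (4 * n%:R + 1) * (2 * eta) <= 1]
}.

Lemma le_radius_le0 (e c : R) : (forall k, e <= c * radius k) -> 0 <= c -> e <= 0.
Proof.
move=> he c0; apply: (@le_geometric_le0 _ _ c) => k; apply: le_trans (he k) _.
rewrite ler_wpM2l// /Defs.radius lef_pV2 ?posrE ?exprn_gt0//.
by rewrite lerXn2r ?nnegrE; lra.
Qed.

Lemma limit_eq z w k0 : construction ->
  (forall k, (k0 <= k)%N -> iterates h k z = w) -> g z = w.
Proof.
move=> con hz; have [a0 ae et _ _] := con_small con.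
apply/eqP; rewrite -subr_eq0; apply/eqP/enorm_eq0/eqP; rewrite eq_le enorm_ge0 andbT.
apply: (@le_radius_le0 _ theta); last by lra.
move=> k; have := con_lim con z (k0 + k); rewrite hz ?leq_addr// => /le_trans; apply.
rewrite ler_wpM2l//; first by lra.
by rewrite radius_add ler_piMl ?radius_le1// ltW// radius_gt0.
Qed.

(** Errors are proportional to [radius k], which is less than [10 * t]. The distance
    [theta * radius k] between [g] and the iterate and the flatness [a * radius k] are each paid at
    two points, whence [20 * (a + theta)]. *)
Lemma limit_flat_near z k (j : index X k) (t : R) : construction -> surface X z ->
    enorm (iterates h k z - center j) < 15 * radius k ->
    0 < t -> radius k.+1 < t -> t <= radius k ->
  (local_dist (g z) t (g @` surface X) (plane_at (p j) (g z))
     <= (20 * (a + theta))%:E)%E.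
Proof.
move=> con Sz zj t0; rewrite radiusS => tk1 tk.
have [a0 ae et t1 _] := con_small con.
have flat := con_flat con k; have hj := coh_proj (con_coh con) j.
set r := radius k in zj tk tk1 *; have r0 : 0 < r := radius_gt0 k.
have rt : 2 * (a + theta) * r <= 20 * (a + theta) * t.
  have -> : 20 * (a + theta) * t = 2 * (a + theta) * (10 * t) by ring.
  by rewrite ler_wpM2l//; lra.
have thr : theta * r <= r / 4 / 50 by have := ler_wpM2r (ltW r0) t1; lra.
have lim u := con_lim con u k; rewrite -/r in lim.
have genz u : surface X u -> generation k (iterates h k u) by move=> Su; exists u.
have zk := flat_near flat (genz _ Sz) (_ : _ < 30 * radius k).
have {}zk : enorm (perp (p j) (iterates h k z - center j)) <= a * r.
  by apply: zk; rewrite -/r; lra.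
have pz := enorm_perp (g z - iterates h k z) hj.
apply: local_dist_plane_le => //.
- move=> _ [u Su <-] uz; apply: le_trans rt.
  have uk : enorm (iterates h k u - center j) < 30 * r.
    have := enorm_triangle (g u) (iterates h k u) (center j).
    have := enorm_triangle (g z) (g u) (center j).
    have := enorm_triangle (iterates h k z) (g z) (center j).
    have := lim u; have := lim z; rewrite (enormB (g u)); lra.
  have := flat_near flat (genz _ Su) uk; rewrite -/r.
  have := enorm_perp (g u - iterates h k u) hj; have := lim u; have := lim z.
  have -> : perp (p j) (g u - g z) =
      perp (p j) (g u - iterates h k u) + perp (p j) (iterates h k u - center j) -
      perp (p j) (iterates h k z - center j) - perp (p j) (g z - iterates h k z).
    rewrite -perpD -!perpB; congr perp; apply/rowP => l; rewrite !mxE; ring.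
  set A := perp _ (g u - _); set B := perp _ (_ u - _).
  set D := perp _ (_ z - center j); set E := perp _ (g z - _) in pz *.
  rewrite -/D in zk; clearbody A B D E.
  have := ler_enormB (A + B - D) E; have := ler_enormB (A + B) D.
  by have := ler_enormD A B; lra.
- move=> v vz pv; have vj : enorm (v - center j) < 20 * r.
    have := enorm_triangle (g z) v (center j).
    have := enorm_triangle (iterates h k z) (g z) (center j).
    have := lim z; lra.
  have [y [[u Su uy] yj yv]] := flat_onto flat vj; rewrite -/r in yj.
  exists (g u); first by exists u.
  apply: le_trans rt.
  have yv' : enorm (y - v) <= 2 * a * r + theta * r.
    have -> : y - v = perp (p j) (y - v) by rewrite /perp yv subr0.
    have -> : perp (p j) (y - v) = perp (p j) (y - center j) -
        perp (p j) (iterates h k z - center j) - perp (p j) (g z - iterates h k z).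
      rewrite -[RHS]subr0 -pv -!perpB; congr perp.
      by apply/rowP => l; rewrite !mxE; ring.
    have ylt : enorm (y - center j) < 30 * radius k by rewrite -/r; lra.
    have yS : generation k y by exists u.
    have := flat_near flat yS ylt; rewrite -/r; have := lim z.
    set A := perp _ (y - center j); set B := perp _ (_ z - center j).
    set D := perp _ (g z - _) in pz *; rewrite -/B in zk; clearbody A B D.
    by have := ler_enormB (A - B) D; have := ler_enormB A B; lra.
  have := enorm_triangle y (g u) v; have := lim u; rewrite uy; lra.
Qed.

Definition far_from_centers k y : Prop :=
  forall j : index X k, 15 * radius k <= enorm (y - center j).

(** A center is within two radii of its parent, so a distance of 10 radii drops to no less than 8,
    while only one is required: 10 radii of the next generation. *)
Lemma far_later k l y : construction ->
  (forall j : index X k, 10 * radius k <= enorm (y - center j)) ->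
  forall j : index X (k + l), 10 * radius (k + l) <= enorm (y - center j).
Proof.
move=> con far; elim: l => [|l ih]; first by rewrite addn0.
rewrite addnS => j; have [i ij] := coh_near (con_coh con) j.
have := ih i; have := enorm_triangle (center j) y (center i).
rewrite radiusS; have : 0 < radius (k + l) :> R := radius_gt0 _.
by lra.
Qed.

(* Around a point far from the centers of generation [k] nothing moves any more. *)
Lemma limit_far z u k : construction -> surface X z -> surface X u ->
  far_from_centers k (iterates h k z) ->
  enorm (iterates h k u - iterates h k z) < 4 * radius k ->
  g u = iterates h k u.
Proof.
move=> con Sz Su far uz; apply: (@limit_eq _ _ k con) => l /subnKC <-.
elim: (l - k)%N => [|m ih]; first by rewrite addn0.
rewrite addnS /= ih (con_far con (k := k + m)) ?addr0//.
  by exists u.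
apply: (far_later con) => j; have := far j.
have := enorm_triangle (iterates h k u) (iterates h k z) (center j).
rewrite (enormB (iterates h k z) (iterates h k u)); have : 0 < radius k :> R := radius_gt0 _.
by lra.
Qed.

Definition generation_graph_at q (c : R) k x : Prop :=
  [/\ orthoproj q, forall z, affine_plane d (plane_at q z),
    forall y y', generation k y -> generation k y' ->
      enorm (y - x) < 4 * radius k -> enorm (y' - x) < 4 * radius k ->
      enorm (perp q (y - y')) <= c * enorm (y - y') &
    forall v, enorm (v - x) < 2 * radius k -> perp q (v - x) = 0 ->
      exists y, [/\ generation k y, enorm (y - x) < 4 * radius k & (y - v) *m q = 0]].

(** No plane of generation [k] is near, but at generation [k - 1] some center was within 15 radii,
    and its plane still serves one step later. The slope [a <= eta] becomes [a + eta] while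
    distances at most halve, whence [4 * eta]. For [k = 0] the initial surface is itself a graph. *)
Lemma generation_graph z k : construction -> surface X z ->
  far_from_centers k (iterates h k z) ->
  (forall l, (l < k)%N -> ~ far_from_centers l (iterates h l z)) ->
  exists q, generation_graph_at q (4 * eta) k (iterates h k z).
Proof.
move=> con Sz far first; have [a0 ae et t1 small] := con_small con.
case: k far first => [|k] far first.
  have [q [hq aff g1 g2]] := con_graph con Sz; exists q; split=> //.
  - move=> _ _ [y Sy <-] [y' Sy' <-] /=; rewrite radius_0 mulr1 => yz y'z.
    apply: le_trans (g1 y y' Sy Sy' yz y'z) _.
    by rewrite ler_wpM2r ?enorm_ge0//; lra.
  - move=> v; rewrite radius_0 !mulr1 => vz pv.
    by have [y [Sy yz yv]] := g2 v vz pv; exists y; split=> //; exists y.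
have /existsNP[i /negP] := first k (ltnSn k); rewrite -ltNge => zi.
have rS : radius k.+1 = radius k / 10 :> R by rewrite radiusS.
set r := radius k in zi rS; have r0 : 0 < r := radius_gt0 k.
have hi := coh_proj (con_coh con) i; have flat := con_flat con k.
have [lip bound] := con_disp con k; rewrite -/r in bound.
have er : eta * r <= r / 4 / 50.
  by have := ler_wpM2r (ltW r0) et; have := ler_wpM2r (ltW r0) t1; lra.
set zk := iterates h k z in zi.
have zkS : generation k zk by exists z.
have zS : iterates h k.+1 z = zk + h k zk by [].
have hz := bound zk; have ar : a * r <= eta * r by rewrite ler_wpM2r// ltW.
exists (p i); split=> //.
- by have [_] := con_plane con i.
- clear small ar; move=> _ _ [u Su <-] [u' Su' <-]; rewrite zS rS /= => uz u'z.
  have near v : enorm (v + h k v - (zk + h k zk)) < 4 * (r / 10) ->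
      enorm (v - center i) < 30 * radius k.
    move=> vz; have := enorm_triangle (v + h k v) v (center i).
    have := enorm_triangle (zk + h k zk) (v + h k v) (center i).
    have := enorm_triangle zk (zk + h k zk) (center i).
    rewrite (enormB v (v + _)) !enorm_addK -/r; have := bound v; lra.
  have uS : generation k (iterates h k u) by exists u.
  have u'S : generation k (iterates h k u') by exists u'.
  have := flat_lip flat uS u'S (near _ uz) (near _ u'z).
  have := lip (iterates h k u) (iterates h k u').
  have := perturb_id_ge (lip (iterates h k u) (iterates h k u')).
  move: (iterates h k u) (iterates h k u') => y y' e1 e2 e3 {uz u'z}.
  have := ler_wpM2r (enorm_ge0 (y - y')) ae.
  have -> : y + h k y - (y' + h k y') = y - y' + (h k y - h k y').
    by rewrite opprD addrACA.
  rewrite perpD; have := ler_enormD (perp (p i) (y - y')) (perp (p i) (h k y - h k y')).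
  have := enorm_perp (h k y - h k y') hi.
  move: e1; rewrite opprD addrACA.
  move: (enorm (y - y')) (enorm_ge0 (y - y')) e2 e3 => e e0 e2 e3 e1 e4 e5 e6.
  have h1 : 2^-1 * e <= (1 - eta) * e by rewrite ler_wpM2r//; lra.
  have h2 : 0 <= 4 * eta by lra.
  by have := ler_wpM2l h2 (le_trans h1 e1); lra.
- move=> v; rewrite zS rS => vz pv.
  pose A := [set y | generation k y /\ enorm (y - center i) < 25 * r].
  have pzk : enorm (perp (p i) (zk - center i)) <= a * r.
    by apply: (flat_near flat) => //; rewrite -/r; lra.
  have vzk : enorm (v - zk) < r / 4.
    by have := enorm_triangle (zk + h k zk) v zk; rewrite enorm_addK; lra.
  have eta20 : 0 <= 2 * eta by lra.
  (* The radius [5 * r] is what remains between the distance [15 * r] from [zk] to the center and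
     the range [20 * r] of [flat_onto]. *)
  have [|||||||||y [[Sy yi] yv yv']] := @projection_lift _ _ A (p i) (p i)
    (fun y => y + h k y) zk (2 * eta) r (5 * r) hi hi eta20 r0 _ _ _ _ _ _ _ v.
  + exact: small.
  + by move=> u; rewrite subrr enorm0 mulr_ge0 ?enorm_ge0.
  + move=> y y' [Sy yi] [Sy' yi']; apply: (@le_trans _ _ (a * enorm (y - y'))).
      by apply: (flat_lip flat (j := i)) => //; rewrite -/r; lra.
    by rewrite ler_wpM2r ?enorm_ge0//; lra.
  + move=> y y' _ _; rewrite (_ : _ - _ = h k y - h k y'); last first.
      by apply/rowP => l; rewrite !mxE; ring.
    by apply: le_trans (lip y y') _; rewrite ler_wpM2r ?enorm_ge0//; lra.
  + by move=> y _; rewrite enorm_addK (le_trans (bound y))// ler_wpM2r//; lra.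
  + move=> y [Sy yi]; have -> : y - zk = y - center i - (zk - center i).
      by rewrite opprB addrA subrK.
    rewrite perpB (le_trans (ler_enormB _ _))//.
    have : enorm (perp (p i) (y - center i)) <= a * r.
      by apply: (flat_near flat) => //; rewrite -/r; lra.
    by lra.
  + move=> u uz; have ui : enorm (u - center i) < 20 * radius k.
      by have := enorm_triangle zk u (center i); rewrite -/r; lra.
    by have [y [Sy yi yu]] := flat_onto flat ui; exists y.
  + by lra.
  + have -> : v - zk = v - (zk + h k zk) + h k zk by rewrite opprD addrA subrK.
    have eta_r0 : 0 <= eta * r := le_trans (enorm_ge0 _) hz.
    by rewrite perpD pv add0r (le_trans (enorm_perp _ hi))//; lra.
  exists (y + h k y); split=> //.
    by case: Sy => u Su <-; exists u.
  have e30 : 15 * (2 * eta) * r <= 30 * (r / 4 / 50) by lra.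
  by have := enorm_triangle v (y + h k y) (zk + h k zk); lra.
Qed.

Lemma limit_reifenberg : construction ->
  reifenberg_flat d (40 * theta) (g @` surface X).
Proof.
move=> con _ t [z Sz <-] /andP[t0 t1]; have [a0 ae et th1 _] := con_small con.
have [k [kt tk]] : exists k, radius k.+1 < t /\ t <= radius k.
  have ex : exists k, radius k < t.
    apply: contrapT => /forallNP hk; have : t <= 0; last by rewrite leNgt t0.
    apply: (@le_radius_le0 _ 1) => // k; rewrite mul1r.
    by have /negP := hk k; rewrite -leNgt.
  case: (ex_minnP ex) => -[|k] kt kmin; first by move: kt; rewrite radius_0; lra.
  exists k; split=> //; rewrite leNgt; apply/negP => /kmin.
  by rewrite ltnn.
have th0 : 0 <= theta by lra.
have [far|near] := pselect (forall l, (l <= k)%N -> ~ far_from_centers l (iterates h l z)).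
  have /existsNP[j /negP] := far k (leqnn k); rewrite -ltNge => zj.
  exists (plane_at (p j) (g z)); split.
  - by have [_] := con_plane con j.
  - by rewrite /plane_at/= subrr /perp mul0mx subr0.
  - apply: le_trans (limit_flat_near con Sz zj t0 kt tk) _; rewrite lee_fin; lra.
have exl : exists l, (l <= k)%N && `[<far_from_centers l (iterates h l z)>].
  apply: contrapT => /forallNP hl; apply: near => l lk farl; apply: (hl l).
  by rewrite lk; apply/asboolP.
(* The first far generation [m] may be much earlier than [k]. Its graph estimate is then used at the
   smaller scale [t], which is possible because a slope bound is invariant under change of scale. *)
case: (ex_minnP exl) => m /andP[mk /asboolP farm] mmin.
have [|q [hq aff g1 g2]] := generation_graph con Sz farm.
  move=> l lm farl; have : (m <= l)%N.
    by apply: mmin; rewrite (leq_trans (ltnW lm) mk)/=; apply/asboolP.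
  by rewrite leqNgt lm.
set x := iterates h m z in farm g1 g2.
have Sx : generation m x by exists z.
have gz : g z = x by apply: (limit_far con Sz Sz farm); rewrite subrr enorm0 mulr_gt0// radius_gt0.
have tm : t <= radius m.
  by apply: le_trans tk _; rewrite -(subnKC mk) radius_add ler_piMr ?radius_le1// ltW// radius_gt0.
have rm0 : 0 < radius m :> R := radius_gt0 m.
have xx : enorm (x - x) < 4 * radius m by rewrite subrr enorm0 mulr_gt0.
exists (plane_at q (g z)); split=> //.
  by rewrite /plane_at/= subrr /perp mul0mx subr0.
have th_t : 4 * eta * t <= 40 * theta * t by rewrite ler_wpM2r ?(ltW t0)//; lra.
have eta0 : 0 <= eta by lra.
rewrite gz; apply: local_dist_plane_le => //.
- move=> _ [u Su <-] ux; have thm : theta * radius m <= radius m / 4 / 50.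
    by have := ler_wpM2r (ltW rm0) th1; lra.
  have um : enorm (iterates h m u - x) < 4 * radius m.
    have := enorm_triangle (g u) (iterates h m u) x; have := con_lim con u m.
    by rewrite (enormB (g u)); lra.
  have gu : g u = iterates h m u := limit_far con Sz Su farm um.
  rewrite gu in ux *; have uS : generation m (iterates h m u) by exists u.
  apply: le_trans (g1 _ _ uS Sx um xx) _; apply: le_trans th_t.
  by rewrite ler_wpM2l ?mulr_ge0// ltW.
- move=> v vx pv; have v2 : enorm (v - x) < 2 * radius m by lra.
  have [y [[u Su uy] yx yv]] := g2 v v2 pv.
  have gu : g u = y by rewrite -uy; apply: (limit_far con Sz Su farm); rewrite uy.
  exists y; first by exists u.
  have yS : generation m y by exists u.
  have lip := g1 y x yS Sx yx xx.
  have yq : (y - x) *m q = v - x.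
    have -> : y - x = y - v + (v - x) by rewrite addrA subrK.
    by rewrite mulmxDl yv add0r {2}(perp_id (v - x) q) pv addr0.
  have y2 : enorm (y - x) <= 2 * enorm (v - x).
    by rewrite -yq; apply: le_double_perp lip; lra.
  have -> : y - v = perp q (y - x).
    by rewrite /perp yq opprB addrA subrK.
  apply: le_trans lip _; apply: (@le_trans _ _ (4 * eta * (2 * t))).
    by rewrite ler_wpM2l ?mulr_ge0//; lra.
  by have := ler_wpM2r (ltW t0) et; lra.
Qed.

End Construction.

(** * Existence of the sequence of maps; surface points near accumulation points *)

Section Existence.
Context {R : realType} {n : nat}.
Variables (d : nat) (eps : R) (X : ccbp_data R n).
Variables (Px : 'rV[R]_n -> set 'rV[R]_n) (Fx : 'rV[R]_n -> 'rV[R]_n -> 'rV[R]_n).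
Implicit Types (u v w x y z : 'rV[R]_n).

Lemma surface_closed z : 0 <= eps -> n%:R * eps <= 1 -> eps <= 1 ->
  smooth_surface d eps (surface X) Px Fx ->
  (forall e, 0 < e -> exists2 y, surface X y & enorm (y - z) < e) -> surface X z.
Proof.
move=> eps0 neps eps1 smooth approx; have [s Ss sz] := approx 1 ltr01.
have [q [_ _ _ [_ _ _ closed]]] := surface_graph eps0 neps eps1 smooth Ss.
by apply: closed => //; rewrite enormB; lra.
Qed.

Lemma surface_graph_at a x : 0 <= eps -> n%:R * eps <= a -> eps <= a -> a <= 1 ->
  smooth_surface d eps (surface X) Px Fx -> surface X x ->
  exists q, graph_at d X q a x.
Proof.
move=> eps0 neps epsa a1 smooth Sx.
have neps1 : n%:R * eps <= 1 by lra.
have eps1 : eps <= 1 by lra.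
have [q [hq _ aff [g1 g2 g3 _]]] := surface_graph eps0 neps1 eps1 smooth Sx.
exists q; split=> // [y y' Sy Sy' yx y'x|v vx pv].
  apply: le_trans (g2 y y' Sy Sy' _ _) _; try lra.
  by rewrite ler_wpM2r ?enorm_ge0.
have v50 : enorm (v - x) < 50 by lra.
have [y [Sy yx yv]] := g3 v v50; exists y; split=> //.
have := enorm_proj_perp q (y - x); have := g1 y Sy yx.
have -> : (y - x) *m q = (v - x) *m q.
  by rewrite -[y - x](subrKA v) mulmxDl yv add0r.
by have := enorm_proj (v - x) hq; lra.
Qed.

Lemma exists_construction (Q a : R) :
  Q = #|colors n|%:R * (#|colors n|%:R + 2) + 2 -> (0 < n)%N -> 0 < eps -> eps <= 60^-1 ->
  smooth_surface d eps (surface X) Px Fx -> coherent_balls eps X ->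
  coherent_planes d eps X Px ->
  (n%:R + 50) * eps <= a / 10 -> 23 * Q * (100 * eps) <= a / 10 ->
  60 * (n%:R + 1) * (4 * n%:R + 1) * (n%:R * Q * a) <= 1 ->
  exists p h g, construction d (100 * eps) a (n%:R * Q * a)
    (2 * n%:R * (n%:R * Q * a)) (X := X) p h g.
Proof.
move=> QE n0 eps0 eps60 smooth balls planes a1 a2 small.
have n1 : 1 <= n%:R :> R by rewrite ler1n.
have Q2 : 2 <= Q by rewrite QE lerDr mulr_ge0// addr_ge0.
have step := @exists_step R n (index X) (@Defs.center R n X).
rewrite -QE in step; clear QE.
have a0 : 0 <= a by have := mulr_ge0 (ler0n R n) (ltW eps0); lra.
have nQ : 1 <= n%:R * Q by rewrite mulr_ege1//; lra.
have a_eta : a <= n%:R * Q * a by rewrite ler_peMl.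
move: small; set eta := n%:R * Q * a in a_eta * => small.
have [p [coh plane]] := ccbp_coherent eps0 balls planes.
have n41 : 0 <= 60 * (n%:R + 1) * (4 * n%:R + 1) :> R by rewrite !mulr_ge0//; lra.
have flat0 : flat_at (@Defs.center R n X) p a (surface X) 0 (surface X).
  apply: (flat_base_surface eps0 eps60 smooth balls planes coh plane a1).
  by apply: le_trans small; rewrite ler_wpM2l.
have delta0 : 0 <= 100 * eps by lra.
(* The map of a step depends on the surface reached, hence on the previous maps. A map is chosen for
   every pair of a generation and a set, with the zero map as default when the set is not flat; the
   recursion [F] then feeds in the actual surfaces. *)
have /choice[H HP] : forall kS : nat * set 'rV[R]_n, exists h,
    flat_at (@Defs.center R n X) p a (surface X) kS.1 kS.2 ->
    [/\ forall z z', enorm (h z - h z') <= eta * enorm (z - z'),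
      forall z, enorm (h z) <= eta * radius kS.1,
      forall z, (forall s, surface X s -> 2 <= enorm (z - s)) -> h z = 0,
      forall y, kS.2 y ->
        (forall j : index X kS.1, 10 * radius kS.1 <= enorm (y - center j)) -> h y = 0 &
      flat_at (@Defs.center R n X) p a (surface X) kS.1.+1 [set z + h z | z in kS.2]].
  move=> [k S] /=.
  have [flat|nflat] := pselect (flat_at (@Defs.center R n X) p a (surface X) k S).
    have [h hP] := step p _ _ _ _ _ n0 coh delta0 flat a2 small.
    by exists h => _; exact: hP.
  by exists (fun=> 0).
pose F := fix F k z := if k is k'.+1 then F k' z + H (k', F k' @` surface X) (F k' z) else z.
pose h k := H (k, F k @` surface X).
have hF k z : iterates h k z = F k z by elim: k => //= k ->.
have genF k : generation X h k = F k @` surface X.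
  by rewrite /generation; congr image; apply/funext => z.
have flat k : flat_at (@Defs.center R n X) p a (surface X) k (F k @` surface X).
  elim: k => [|k ih]; first by rewrite image_id.
  have [_ _ _ _] := HP (k, F k @` surface X) ih; rewrite /= image_comp.
  exact.
have disp : small_displacements h eta.
  by move=> k; have [h1 h2 _ _ _] := HP (k, F k @` surface X) (flat k).
have eta0 : 0 <= eta by lra.
have [g gP] := limit_map disp eta0.
exists p, h, g; split=> //.
- move=> k y; rewrite genF => yS far.
  by have [_ _ _ h4 _] := HP (k, F k @` surface X) (flat k); exact: h4.
- by move=> k z zS; have [_ _ h3 _ _] := HP (k, F k @` surface X) (flat k); exact: h3.
- by move=> k; rewrite genF.
- move=> x Sx; have neps0 : 0 <= n%:R * eps by rewrite mulr_ge0//; lra.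
  apply: surface_graph_at smooth Sx; [lra|lra|lra|].
  by apply: le_trans a_eta _; apply: le_trans small; rewrite ler_peMl//; nra.
- split=> //.
  + by rewrite ler_peMl//; lra.
  + have coef : 50 * (2 * n%:R) <= 15 * (n%:R + 1) * (4 * n%:R + 1) :> R by nra.
    by have := ler_wpM2r eta0 coef; lra.
  + have coef : 0 <= 48 * (n%:R + 1) * (4 * n%:R + 1) :> R by nra.
    by have := mulr_ge0 coef eta0; lra.
Qed.

Variables (delta a eta theta : R) (p : forall k, index X k -> 'M[R]_n).
Variables (h : nat -> 'rV[R]_n -> 'rV[R]_n) (g : 'rV[R]_n -> 'rV[R]_n).

(** Surjectivity of the projection, applied at a center, gives a point of the same generation within
    25 radii of it, and [g] adds at most one radius. The factor [n + 1] converts the sup norm in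
    which the limit is taken. *)
Lemma limit_near_accumulation x e : construction d delta a eta theta p h g ->
  accumulation_set X x -> 0 < e ->
  exists2 z, surface X z & enorm (g z - x) < e.
Proof.
move=> con [k [j [k_oo j_x]]] e0; have [a0 ae et th1 _] := con_small con.
have e60 : 0 < e / 60 by lra.
have [N rN] : exists N, radius N <= e / 60.
  apply: contrapT => /forallNP far; have : e / 60 <= 0; last by rewrite leNgt e60.
  apply: (@le_radius_le0 _ _ 1) => // l; rewrite mul1r.
  by have /negP := far l; rewrite -ltNge => /ltW.
have n1 : 0 < n%:R + 1 :> R by rewrite ltr_wpDl.
have e1 : 0 < e / 60 / (n%:R + 1) by rewrite divr_gt0.
have [m [mN mx]] : exists m, (N <= k m)%N /\ `|x - center (j m)| < e / 60 / (n%:R + 1).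
  have h1 : \forall m \near \oo, (N <= k m)%N by move/cvgnyPge: k_oo; exact.
  have h2 : \forall m \near \oo, `|x - center (j m)| < e / 60 / (n%:R + 1).
    by move/cvgrPdist_lt: j_x; exact.
  by have [m] := filter_ex (filterI h1 h2); exists m.
have {}mx : enorm (center (j m) - x) <= e / 60.
  rewrite enormB; apply: le_trans (ler_enorm_norm _) _.
  have : (n%:R + 1) * `|x - center (j m)| <= e / 60.
    by rewrite mulrC -ler_pdivlMr// ltW.
  by have := normr_ge0 (x - center (j m)); lra.
have rk : radius (k m) <= e / 60.
  by apply: le_trans rN; rewrite -(subnKC mN) radius_add ler_piMr ?radius_le1// ltW// radius_gt0.
have r0 : 0 < radius (k m) :> R := radius_gt0 _.
have c20 : enorm (center (j m) - center (j m)) < 20 * radius (k m).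
  by rewrite subrr enorm0 mulr_gt0.
have [_ [[z Sz <-] zj _]] := flat_onto (con_flat con (k m)) c20.
exists z => //; have := con_lim con z (k m).
have th : theta * radius (k m) <= radius (k m) by rewrite ler_piMl//; lra.
have := enorm_triangle (iterates h (k m) z) (g z) x.
have := enorm_triangle (center (j m)) (iterates h (k m) z) x.
lra.
Qed.

End Existence.

(** * Properties of the limit map *)

Section LimitProperties.
Context {R : realType} {n : nat}.
Variables (d : nat) (delta a eta theta : R) (X : ccbp_data R n).
Variables (p : forall k, index X k -> 'M[R]_n).
Variables (h : nat -> 'rV[R]_n -> 'rV[R]_n) (g : 'rV[R]_n -> 'rV[R]_n).
Implicit Types (u v w x y z : 'rV[R]_n).

Lemma limit_move z : construction d delta a eta theta p h g ->
  enorm (g z - z) <= theta.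
Proof. by move=> con; have := con_lim con z 0; rewrite radius_0 mulr1. Qed.

Lemma limit_holder (beta : R) z z' : construction d delta a eta theta p h g ->
  2 * theta <= beta -> beta < 1 -> enorm (z' - z) <= 1 ->
  4^-1 * enorm (z' - z) `^ (1 + beta) <= enorm (g z' - g z)
    <= 3 * enorm (z' - z) `^ (1 - beta).
Proof.
move=> con b1 b2 zz'; have [a0 ae et th1 _] := con_small con.
have eta0 : 0 <= eta by lra.
have th2 : 50 * theta <= 1 by lra.
exact: (limit_map_holder (con_disp con) eta0 et th2 (con_lim con)).
Qed.

Lemma limit_surj w : construction d delta a eta theta p h g -> exists z, g z = w.
Proof.
move=> con; have [a0 ae et th1 small] := con_small con.
have n0 : 0 <= n%:R :> R by [].
have eta0 : 0 <= eta by lra.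
apply: (limit_map_surj (con_lim con) w (con_disp con) eta0); last by lra.
have neta : n%:R * eta <= n%:R * n%:R * eta + n%:R * eta by rewrite lerDr !mulr_ge0.
by have : 0 <= n%:R * n%:R * eta; [rewrite !mulr_ge0 | lra].
Qed.

Lemma limit_expand z z' : construction d delta a eta theta p h g ->
  enorm (z' - z) <= enorm (g z' - g z) + 2 * theta.
Proof.
move=> con; have := limit_move z con; have := limit_move z' con.
have := enorm_triangle (g z') z' z; have := enorm_triangle (g z) (g z') z.
by rewrite (enormB z' (g z')); lra.
Qed.

(** The lower Hoelder bound is available only at distance at most 1; [limit_expand] first shows that
    points with equal images are at most [2 * theta] apart. *)
Lemma limit_inj : construction d delta a eta theta p h g -> injective g.
Proof.
move=> con z' z gzz'; have [a0 ae et th1 _] := con_small con.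
have := limit_expand z z' con; rewrite gzz' subrr enorm0 add0r => zz'.
have b1 : 2 * theta < 1 by lra.
have zz1 : enorm (z' - z) <= 1 by lra.
have := limit_holder con (lexx _) b1 zz1.
move=> /andP[+ _]; rewrite gzz' subrr enorm0 pmulr_rle0 ?invr_gt0// => le0.
apply/eqP; rewrite -subr_eq0; apply/eqP/enorm_eq0.
apply: (@powR_eq0_eq0 _ _ (1 + 2 * theta)); apply/eqP.
by rewrite eq_le le0 powR_ge0.
Qed.

Lemma limit_fix z : construction d delta a eta theta p h g ->
  (forall s, surface X s -> 2 <= enorm (z - s)) -> g z = z.
Proof.
move=> con far; apply: (limit_eq (k0 := 0) con) => k _.
by elim: k => //= k ->; rewrite (con_fix con)// addr0.
Qed.

(** An accumulation point has a preimage [z], as [g] is onto, and is approached by images of surface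
    points. The lower Hoelder bound makes these surface points approach [z], and closedness
    concludes; the threshold 1/2 brings them within distance 1 of [z], where that bound applies. *)
Lemma limit_accumulation : construction d delta a eta theta p h g ->
  (forall z, (forall e, 0 < e -> exists2 y, surface X y & enorm (y - z) < e) ->
    surface X z) ->
  accumulation_set X `<=` g @` surface X.
Proof.
move=> con closed x acc; have [a0 ae et th1 _] := con_small con.
have [z gz] := limit_surj x con; exists z => //; apply: closed => e e0.
pose c := 4^-1 * e `^ (1 + 2 * theta).
have c0 : 0 < Num.min c 2^-1.
  by rewrite lt_min invr_gt0 ltr0n andbT mulr_gt0// powR_gt0.
have [y Sy yx] := limit_near_accumulation con acc c0.
move: yx; rewrite lt_min => /andP[yc y2]; exists y => //.
rewrite ltNge; apply/negP => ey.
have := limit_expand z y con; rewrite gz => yz.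
have b1 : 2 * theta < 1 by lra.
have yz1 : enorm (y - z) <= 1 by lra.
have := limit_holder con (lexx _) b1 yz1.
move=> /andP[+ _]; rewrite gz leNgt => /negP; apply; apply: lt_le_trans yc _.
rewrite ler_wpM2l ?invr_ge0//; apply: ge0_ler_powR; rewrite ?nnegrE//; lra.
Qed.

End LimitProperties.

Theorem theorem2p15 (R : realType) (n d : nat) (hdn : (0 < d < n)%N) :
  exists (eps0 C : R), [/\ 0 < eps0, 1 <= C &
    forall (eps : R) (X : ccbp_data R n), 0 < eps <= eps0 -> is_CCBP d eps X ->
    exists g : 'rV[R]_n -> 'rV[R]_n,
      [/\ bijective g,
          forall z, (2%:E <= set_dist z (surface X))%E -> g z = z,
          forall z, enorm (g z - z) <= C * eps,
          forall z z', enorm (z' - z) <= 1 ->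
            4^-1 * enorm (z' - z) `^ (1 + C * eps) <= enorm (g z' - g z)
              <= 3 * enorm (z' - z) `^ (1 - C * eps) &
          reifenberg_flat d (C * eps) (g @` surface X) /\
          accumulation_set X `<=` g @` surface X]].
Proof.
have n0 : (0 < n)%N by have /andP[d0 dn] := hdn; exact: ltn_trans d0 dn.
have n1 : 1 <= n%:R :> R by rewrite ler1n.
have [Q QE] : exists Q : R, Q = #|colors n|%:R * (#|colors n|%:R + 2) + 2 by eexists.
have Q2 : 2 <= Q by rewrite QE lerDr mulr_ge0// addr_ge0.
(* The flatness constant will be [A * eps]; the sum covers at once the two lower bounds that
   [exists_construction] puts on it. *)
pose A : R := 10 * (23 * Q * 100 + (n%:R + 50)).
have A1 : 1 <= A by rewrite /A; lra.
pose B := n%:R * Q * A.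
have B1 : 1 <= B by rewrite /B !mulr_ege1//; lra.
(* The inequality [K * eps <= 1] is the smallness condition on [eta = B * eps]. *)
pose K := 60 * (n%:R + 1) * (4 * n%:R + 1) * B.
have coef : 60 <= 60 * (n%:R + 1) * (4 * n%:R + 1) :> R by nra.
have K60 : 60 <= K by apply: le_trans coef _; rewrite /K ler_peMr//; lra.
have nB : 1 <= n%:R * B by rewrite mulr_ege1.
exists K^-1, (80 * (n%:R * B)); split; [by rewrite invr_gt0; lra | by lra |].
move=> eps X /andP[eps0 epsK] [Px [Fx [smooth balls planes]]].
have K0 : 0 < K by lra.
have Keps : K * eps <= 1 by rewrite -ler_pdivlMl// mulr1.
have eps60 : eps <= 60^-1 by have := ler_wpM2r (ltW eps0) K60; lra.
have neps0 : 0 <= n%:R * eps by rewrite mulr_ge0// ltW.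
have Qeps0 : 0 <= Q * eps by rewrite mulr_ge0//; lra.
have [|||p [h [g]]] := exists_construction (a := A * eps) QE n0 eps0 eps60 smooth balls planes.
- by rewrite /A; lra.
- by rewrite /A; lra.
- by apply: le_trans Keps; rewrite /K /B !mulrA.
have -> : n%:R * Q * (A * eps) = B * eps by rewrite /B !mulrA.
set eta := B * eps; set theta := 2 * n%:R * eta => con.
(* Reifenberg flatness costs [40 * theta], with [theta = 2 * n * B * eps]: this fixes [C]. The
   displacement and the exponents only ask for [theta] and [2 * theta]. *)
have CE : 80 * (n%:R * B) * eps = 40 * theta by rewrite /theta /eta; ring.
have [a0 ae et th1 _] := con_small con.
rewrite CE; exists g; split.
- have /choice[f fK] w : exists z, g z = w by exact: limit_surj con.
  by exists f => [z|//]; apply: (limit_inj con); rewrite fK.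
- move=> z far; apply: (limit_fix con) => s Ss; rewrite -lee_fin.
  by apply: le_trans far _; apply: ereal_inf_lbound; exists s.
- by move=> z; apply: le_trans (limit_move z con) _; lra.
- by move=> z z' zz'; apply: (limit_holder con) => //; lra.
- split; first exact: limit_reifenberg con.
  apply: (limit_accumulation con) => z; apply: surface_closed smooth; [lra| |lra].
  have : n%:R * eps <= K * eps; last by lra.
  rewrite ler_wpM2r ?(ltW eps0)// (le_trans _ (_ : 60 * (n%:R + 1) * (4 * n%:R + 1) <= K))//.
    nra.
  by rewrite /K ler_peMr//; lra.
Qed.
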